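(* There is a polynomial-time many-one reduction from the problem of long-term relevance of a Boolean access for a Boolean positive query in a given configuration to the \emph{complement} of the problem of query containment of Boolean positive queries under access limitations, starting from another configuration.
   Context: Model. A schema is a finite set of relations, each with a set of attributes; each attribute $a$ has an abstract domain $\mathrm{Dom}(a)$ taken from a countable set of abstract domains (attributes may share a domain; different domains may overlap). An instance $I$ gives a set $I(S)$ of tuples for each relation $S$. A configuration $\mathrm{Conf}$ is a subset of some instance (relation by relation); it is consistent with $I$ if $\mathrm{Conf}\subseteq I$. An access method consists of a relation $R$ and a set of input attributes among the attributes of $R$ (the others are output attributes); each method is either dependent or independent. A relation may have zero, one or several access methods; with none, its content stays that of the initial configuration. An access is an access method together with a binding $\mathrm{Bind}$ of values to its input attributes; it is Boolean if there are no output attributes. The active domain of $\mathrm{Conf}$ is the set of pairs (constant, abstract domain) such that the constant occurs in $\mathrm{Conf}$ at an attribute with that domain. An access is well-formed at $\mathrm{Conf}$ if its method is independent, or its method is dependent and each bound value, paired with the domain of its input attribute, is in the active domain of $\mathrm{Conf}$. A well-formed access to $R$ with binding $\mathrm{Bind}$ at $\mathrm{Conf}$ on an instance $I\supseteq\mathrm{Conf}$ leads, non-deterministically, to any configuration $\mathrm{Conf}\cup\mathrm{Resp}$ where the response $\mathrm{Resp}$ is any set of tuples of $I(R)$ agreeing with $\mathrm{Bind}$ on the input attributes (accesses are sound but not necessarily exact). A configuration is reachable from $\mathrm{Conf}$ if some sequence of well-formed accesses (on some instance consistent with $\mathrm{Conf}$) can lead from $\mathrm{Conf}$ to it. Queries.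 Positive queries are first-order formulas without universal quantifiers or negation. A variable occurring in several attributes requires these to have the same abstract domain, and all constants of a query are assumed to be present in the configuration. A Boolean query is certain at $\mathrm{Conf}$ if it is true in every instance consistent with $\mathrm{Conf}$. Containment. $Q_1$ is contained in $Q_2$ under a set $\mathrm{ACS}$ of access methods starting from $\mathrm{Conf}$ if $Q_1(\mathrm{Conf}')\subseteq Q_2(\mathrm{Conf}')$ for every configuration $\mathrm{Conf}'$ reachable from $\mathrm{Conf}$. The containment problem takes as input the schema, $\mathrm{ACS}$, $\mathrm{Conf}$, $Q_1$ and $Q_2$. Long-term relevance. A path from an access $\alpha_1$ starting from $\mathrm{Conf}$ on $I$ is a sequence $\mathrm{Conf}_1,\alpha_1,\mathrm{Conf}_2,\alpha_2,\dots,\alpha_{n-1},\mathrm{Conf}_n$ with $\mathrm{Conf}_1=\mathrm{Conf}$ and each $\mathrm{Conf}_{i+1}=\mathrm{Conf}_i\cup\mathrm{Resp}_i$ a successor configuration of the well-formed access $\alpha_i$ at $\mathrm{Conf}_i$ on $I$. Its truncated path drops $\alpha_1$ and performs $\alpha_2,\dots,\alpha_i$ with the same responses, $\mathrm{Conf}'_1=\mathrm{Conf}_1$, $\mathrm{Conf}'_j=\mathrm{Conf}'_{j-1}\cup\mathrm{Resp}_j$, where $i$ is maximal such that every $\alpha_j$ ($2\le j\le i$) is well-formed at $\mathrm{Conf}'_{j-1}$. The access $\alpha_1$ is long-term relevant for a Boolean query $Q$ at $\mathrm{Conf}$ if for some instance $I$ consistent with $\mathrm{Conf}$ and some path $p$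 beginning with $\alpha_1$, $Q$ is certain at the final configuration of $p$ but not at the final configuration of its truncated path. The long-term relevance problem takes as input the schema, the access methods, the configuration, the (well-formed) access and the query. *)

(* Defs.v *)
From mathcomp Require Import all_boot.
From mathcomp Require Import boolp classical_sets.

Set Implicit Arguments.
Unset Strict Implicit.
Unset Printing Implicit Defensive.

Local Open Scope classical_set_scope.

(* Relations, constants, abstract domains and variables are all named by bit
   strings.  An abstract domain is a label: every constant may occur at every
   attribute, and one constant may occur under several domains. *)
Definition name := seq bool.

(* The attributes of a relation are the positions of a list, which gives the
   abstract domain of each of them. *)
Definition schema := seq (name * seq name).

Definition rels (sch : schema) : seq name := unzip1 sch.

Definition doms (sch : schema) (r : name) : seq name :=
  nth [::] (unzip2 sch) (index r (rels sch)).

Definition schema_ok (sch : schema) : bool := uniq (rels sch).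

Definition fact := (name * seq name)%type.

Definition fact_ok (sch : schema) (f : fact) : bool :=
  (f.1 \in rels sch) && (size f.2 == size (doms sch f.1)).

Definition is_instance (sch : schema) (I : set fact) : Prop :=
  forall f, I f -> fact_ok sch f.

(* Pairs (constant, abstract domain). *)
Definition adom (sch : schema) (C : set fact) : set (name * name) :=
  [set p | exists2 f, C f & p \in zip f.2 (doms sch f.1)].

(* Relation, mask of the input attributes, and [true] iff dependent. *)
Definition method := (name * seq bool * bool)%type.
Definition mrel (m : method) : name := m.1.1.
Definition minputs (m : method) : seq bool := m.1.2.
Definition mdependent (m : method) : bool := m.2.

Definition method_ok (sch : schema) (m : method) : bool :=
  (mrel m \in rels sch) && (size (minputs m) == size (doms sch (mrel m))).

(* The binding lists the values of the input attributes, in order. *)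
Definition access := (method * seq name)%type.

Definition is_boolean (a : access) : bool := all id (minputs a.1).

Definition input_doms (sch : schema) (m : method) : seq name :=
  mask (minputs m) (doms sch (mrel m)).

Definition well_formed (sch : schema) (acs : seq method) (C : set fact)
    (a : access) : Prop :=
  [/\ a.1 \in acs,
      size a.2 = size (input_doms sch a.1) &
      mdependent a.1 ->
        forall p, p \in zip a.2 (input_doms sch a.1) -> adom sch C p].

Definition is_response (I : set fact) (a : access) (resp : set fact) : Prop :=
  resp `<=`
    [set f | [/\ I f, f.1 = mrel a.1 & mask (minputs a.1) f.2 = a.2]].

(* The configurations of a path are determined by its first configuration and
   by its sequence of accesses and responses. *)
Definition path := seq (access * set fact).

Definition final (C : set fact) (p : path) : set fact :=
  foldl (fun D s => D `|` s.2) C p.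

Fixpoint path_well_formed (sch : schema) (acs : seq method) (C : set fact)
    (p : path) : Prop :=
  if p is s :: p' then
    well_formed sch acs C s.1 /\ path_well_formed sch acs (C `|` s.2) p'
  else True.

Fixpoint responses_on (I : set fact) (p : path) : Prop :=
  if p is s :: p' then is_response I s.1 s.2 /\ responses_on I p' else True.

Definition is_path (sch : schema) (acs : seq method) (I C : set fact)
    (p : path) : Prop :=
  path_well_formed sch acs C p /\ responses_on I p.

Definition consistent (sch : schema) (C I : set fact) : Prop :=
  is_instance sch I /\ C `<=` I.

Definition reachable (sch : schema) (acs : seq method) (C C' : set fact)
    : Prop :=
  exists I p, [/\ consistent sch C I, is_path sch acs I C p & C' = final C p].

(* [q] is the truncated path of a path [s :: p] starting from [C]: the longest
   prefix of [p] that is well-formed from [C]. *)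
Definition is_truncated (sch : schema) (acs : seq method) (C : set fact)
    (p q : path) : Prop :=
  exists k, [/\ q = take k p, k <= size p, path_well_formed sch acs C q &
    forall j, j <= size p -> path_well_formed sch acs C (take j p) -> j <= k].

Inductive term := Var of name | Cst of name.

Inductive pquery :=
| PAtom of name & seq term
| PEq of term & term
| PAnd of pquery & pquery
| POr of pquery & pquery
| PExists of name & pquery.

Definition tval (v : name -> name) (t : term) : name :=
  match t with Var x => v x | Cst c => c end.

Definition upd (A : eqType) (B : Type) (v : A -> B) (x : A) (b : B) : A -> B :=
  fun y => if y == x then b else v y.

(* Quantifiers range over the infinite set of all constants. *)
Fixpoint sat (C : set fact) (v : name -> name) (q : pquery) : Prop :=
  match q with
  | PAtom r ts => C (r, map (tval v) ts)
  | PEq t u => tval v t = tval v u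
  | PAnd q1 q2 => sat C v q1 /\ sat C v q2
  | POr q1 q2 => sat C v q1 \/ sat C v q2
  | PExists x q1 => exists c, sat C (upd v x c) q1
  end.

Definition holds (C : set fact) (q : pquery) : Prop := forall v, sat C v q.

Definition certain (sch : schema) (C : set fact) (q : pquery) : Prop :=
  forall I, consistent sch C I -> holds I q.

Definition tvars (t : term) : seq name :=
  if t is Var x then [:: x] else [::].

Definition tconsts (t : term) : seq name :=
  if t is Cst c then [:: c] else [::].

Fixpoint free_vars (q : pquery) : seq name :=
  match q with
  | PAtom _ ts => flatten (map tvars ts)
  | PEq t u => tvars t ++ tvars u
  | PAnd q1 q2 | POr q1 q2 => free_vars q1 ++ free_vars q2
  | PExists x q1 => [seq y <- free_vars q1 | y != x]
  end.

Fixpoint consts (q : pquery) : seq name :=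
  match q with
  | PAtom _ ts => flatten (map tconsts ts)
  | PEq t u => tconsts t ++ tconsts u
  | PAnd q1 q2 | POr q1 q2 => consts q1 ++ consts q2
  | PExists _ q1 => consts q1
  end.

Definition term_typed (G : name -> name) (t : term) (d : name) : bool :=
  if t is Var x then G x == d else true.

(* [G] gives the abstract domain of each variable. *)
Fixpoint typed (sch : schema) (G : name -> name) (q : pquery) : Prop :=
  match q with
  | PAtom r ts =>
      [/\ r \in rels sch, size ts = size (doms sch r) &
          all (fun td => term_typed G td.1 td.2) (zip ts (doms sch r))]
  | PEq t u => exists d, term_typed G t d && term_typed G u d
  | PAnd q1 q2 | POr q1 q2 => typed sch G q1 /\ typed sch G q2
  | PExists x q1 => exists d, typed sch (upd G x d) q1
  end.

(* Boolean positive queries all of whose constants occur in [C]. *)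
Definition query_ok (sch : schema) (C : seq fact) (q : pquery) : Prop :=
  [/\ free_vars q = [::], exists G, typed sch G q &
      forall c, c \in consts q -> exists2 f, f \in C & c \in f.2].

(* Binary trees as data of a WHILE language, as in Jones, "Computability and
   Complexity".  Evaluating an expression costs the sizes of the values of all
   its subexpressions, so that the running time bounds the size of all data
   created: up to a polynomial, this is the running time of a Turing machine. *)
Inductive tree := Leaf | Node of tree & tree.

Fixpoint tree_size (t : tree) : nat :=
  if t is Node l r then (tree_size l + tree_size r).+1 else 1.

Fixpoint tree_eq (t u : tree) : bool :=
  match t, u with
  | Leaf, Leaf => true
  | Node l r, Node l' r' => tree_eq l l' && tree_eq r r'
  | _, _ => false
  end.

Definition store := nat -> tree.

Inductive expr :=
| EVar of nat
| ELeaf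
| ENode of expr & expr
| ELeft of expr
| ERight of expr
| EEq of expr & expr.

Fixpoint eval (s : store) (e : expr) : tree :=
  match e with
  | EVar x => s x
  | ELeaf => Leaf
  | ENode e1 e2 => Node (eval s e1) (eval s e2)
  | ELeft e1 => if eval s e1 is Node l _ then l else Leaf
  | ERight e1 => if eval s e1 is Node _ r then r else Leaf
  | EEq e1 e2 => if tree_eq (eval s e1) (eval s e2) then Node Leaf Leaf else Leaf
  end.

Fixpoint cost (s : store) (e : expr) : nat :=
  tree_size (eval s e) +
  match e with
  | EVar _ | ELeaf => 0
  | ENode e1 e2 | EEq e1 e2 => cost s e1 + cost s e2
  | ELeft e1 | ERight e1 => cost s e1
  end.

Inductive cmd :=
| CAssign of nat & expr
| CSeq of cmd & cmd
| CIf of expr & cmd & cmd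
| CWhile of expr & cmd.

(* [exec c s n s']: started in [s], [c] halts in [s'] after time [n]. *)
Inductive exec : cmd -> store -> nat -> store -> Prop :=
| exec_assign x e s :
    exec (CAssign x e) s (cost s e) (upd s x (eval s e))
| exec_seq c1 c2 s s' s'' n1 n2 :
    exec c1 s n1 s' -> exec c2 s' n2 s'' -> exec (CSeq c1 c2) s (n1 + n2) s''
| exec_if_true e c1 c2 s s' n :
    eval s e <> Leaf -> exec c1 s n s' ->
    exec (CIf e c1 c2) s (cost s e + n) s'
| exec_if_false e c1 c2 s s' n :
    eval s e = Leaf -> exec c2 s n s' ->
    exec (CIf e c1 c2) s (cost s e + n) s'
| exec_while_true e c s s' s'' n1 n2 :
    eval s e <> Leaf -> exec c s n1 s' -> exec (CWhile e c) s' n2 s'' ->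
    exec (CWhile e c) s (cost s e + n1 + n2) s''
| exec_while_false e c s :
    eval s e = Leaf -> exec (CWhile e c) s (cost s e) s.

(* The input and the output are held by variable 0. *)
Definition init (t : tree) : store := upd (fun _ => Leaf) 0 t.

(* A problem is posed on its valid inputs only; nothing is asked of a reduction
   elsewhere. *)
Record problem := Problem {
  input : Type;
  valid : input -> Prop;
  yes : input -> Prop;
  encode : input -> tree
}.

Definition complement (P : problem) : problem :=
  @Problem (input P) (@valid P) (fun x => ~ yes x) (@encode P).

Definition polytime (P Q : problem) (f : input P -> input Q) : Prop :=
  exists (c : cmd) (k : nat), forall x, valid x ->
    exists n s, [/\ exec c (init (encode x)) n s, s 0 = encode (f x) &
                    n <= k * tree_size (encode x) ^ k + k].

Definition polytime_many_one_reducible (P Q : problem) : Prop :=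
  exists2 f : input P -> input Q, polytime f &
    forall x, valid x -> valid (f x) /\ (yes x <-> yes (f x)).

Definition enc_bool (b : bool) : tree := if b then Node Leaf Leaf else Leaf.

Definition enc_seq (T : Type) (e : T -> tree) (s : seq T) : tree :=
  foldr (fun x t => Node (e x) t) Leaf s.

Definition enc_pair (T U : Type) (e : T -> tree) (e' : U -> tree) (p : T * U) :
  tree := Node (e p.1) (e' p.2).

Definition enc_name : name -> tree := enc_seq enc_bool.

Definition enc_fact : fact -> tree := enc_pair enc_name (enc_seq enc_name).

Definition enc_schema : schema -> tree :=
  enc_seq (enc_pair enc_name (enc_seq enc_name)).

Definition enc_method : method -> tree :=
  enc_pair (enc_pair enc_name (enc_seq enc_bool)) enc_bool.

Definition enc_access : access -> tree :=
  enc_pair enc_method (enc_seq enc_name).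

Definition tag (n : nat) (t : tree) : tree := Node (iter n (Node Leaf) Leaf) t.

Definition enc_term (t : term) : tree :=
  match t with
  | Var x => tag 0 (enc_name x)
  | Cst c => tag 1 (enc_name c)
  end.

Fixpoint enc_query (q : pquery) : tree :=
  match q with
  | PAtom r ts => tag 0 (Node (enc_name r) (enc_seq enc_term ts))
  | PEq t u => tag 1 (Node (enc_term t) (enc_term u))
  | PAnd q1 q2 => tag 2 (Node (enc_query q1) (enc_query q2))
  | POr q1 q2 => tag 3 (Node (enc_query q1) (enc_query q2))
  | PExists x q1 => tag 4 (Node (enc_name x) (enc_query q1))
  end.

Record setting := Setting {
  sch : schema;
  acs : seq method;
  conf : seq fact
}.

Definition conf_set (st : setting) : set fact := [set` conf st].

Definition setting_ok (st : setting) : Prop :=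
  [/\ schema_ok (sch st), all (method_ok (sch st)) (acs st) &
      all (fact_ok (sch st)) (conf st)].

Definition enc_setting (st : setting) : tree :=
  Node (enc_schema (sch st))
       (Node (enc_seq enc_method (acs st)) (enc_seq enc_fact (conf st))).

Definition long_term_relevant (st : setting) (a : access) (q : pquery) : Prop :=
  exists I resp p p',
    let C := conf_set st in
    [/\ consistent (sch st) C I,
        is_path (sch st) (acs st) I C ((a, resp) :: p),
        is_truncated (sch st) (acs st) C p p',
        certain (sch st) (final C ((a, resp) :: p)) q &
        ~ certain (sch st) (final C p') q].

Definition contained (st : setting) (q1 q2 : pquery) : Prop :=
  forall C, reachable (sch st) (acs st) (conf_set st) C ->
    holds C q1 -> holds C q2.

Definition ltr_problem : problem := {|
  input := setting * access * pquery;
  valid := fun '(st, a, q) =>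
    [/\ setting_ok st, is_boolean a,
        well_formed (sch st) (acs st) (conf_set st) a &
        query_ok (sch st) (conf st) q];
  yes := fun '(st, a, q) => long_term_relevant st a q;
  encode := enc_pair (enc_pair enc_setting enc_access) enc_query
|}.

Definition containment_problem : problem := {|
  input := setting * pquery * pquery;
  valid := fun '(st, q1, q2) =>
    [/\ setting_ok st, query_ok (sch st) (conf st) q1 &
        query_ok (sch st) (conf st) q2];
  yes := fun '(st, q1, q2) => contained st q1 q2;
  encode := enc_pair (enc_pair enc_setting enc_query) enc_query
|}.

(* Main.v *)
From mathcomp Require Import all_boot zify.
From mathcomp Require Import boolp classical_sets.
Require Import Defs.

Set Implicit Arguments.
Unset Strict Implicit.
Unset Printing Implicit Defensive.

(** Let C be the configuration, f the fact that the Boolean access asks for, and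
    Q the query.  An independent access may bring in new values; dropping it
    then truncates the path at the first access that uses one of them.  Hence
    the access is long-term relevant iff for some D reachable from C, Q fails in
    D and
    - either Q holds in D + f,
    - or some access is well-formed at D + f but not at D, and Q holds in some
      configuration E reachable from C + f.
    (In the second case E need not contain D: whatever is reachable from C is
    reachable from C + f as well.)

    Renaming the values of D that are not in C to fresh ones preserves
    reachability and the failure of Q, so that the new values of f may be assumed
    absent from D.  An access as in the second case then exists iff some
    dependent method has an input domain for which f has a new value, and each
    of its input domains is a domain of f or is inhabited in D.  Which methods
    satisfy the first condition is computed by the reduction; the other one is
    a positive query over D.

    The containment instance consists of two disjoint copies of the setting,
    with distinct abstract domains, starting from C and from C + f.  Its
    reachable configurations are the pairs (D, E).  The right-hand query is Q
    over D; the left-hand one is the disjunction of the two cases. *)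

(** * Polynomial-time programs *)

(** The base [n.+2] is at least 2 for every [n], so that constants and sums are absorbed by the
    exponent. *)
Definition pol (g : nat -> nat) := exists k, forall n, g n <= n.+2 ^ k.

Lemma pol_exp k : pol (fun n => n.+2 ^ k).
Proof. by exists k. Qed.

Lemma pol_const c : pol (fun=> c).
Proof.
exists c => n; apply: leq_trans (ltnW (ltn_expl c (isT : 1 < 2))) _.
by case: c => // c; rewrite leq_exp2r.
Qed.

Lemma pol_id : pol id.
Proof. by exists 1 => n; rewrite expn1; lia. Qed.

Lemma pol_add f g : pol f -> pol g -> pol (fun n => f n + g n).
Proof.
move=> [k hk] [l hl]; exists (k + l).+1 => n.
(* The extra factor [n.+2] supplies two copies of the power with exponent [k + l], one for each
   summand. *)
rewrite expnS mulSn addnC [n.+1 * _]mulSn.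
apply: leq_add; last apply: (leq_trans _ (leq_addr _ _)).
  by apply: leq_trans (hl n) _; rewrite leq_exp2l //; lia.
by apply: leq_trans (hk n) _; rewrite leq_exp2l //; lia.
Qed.

Lemma pol_mul f g : pol f -> pol g -> pol (fun n => f n * g n).
Proof.
move=> [k hk] [l hl]; exists (k + l) => n.
by rewrite expnD; apply: leq_mul.
Qed.

Lemma pol_comp k f : pol f -> pol (fun n => (f n).+2 ^ k).
Proof.
move=> pf; have [l hl] : pol (fun n => f n + 2) by apply/pol_add/pol_const.
exists (l * k) => n; rewrite expnM.
by case: k => // k; rewrite leq_exp2r // -addn2.
Qed.

Create HintDb pol.
#[local] Hint Resolve pol_exp pol_const pol_id pol_add pol_mul pol_comp : pol.

Definition computes T (e F : T -> tree) (c : cmd) (N : nat) (g : nat -> nat) :=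
  forall x s, s 0 = e x -> exists n s',
    [/\ exec c s n s', s' 0 = F x, forall y, N <= y -> s' y = s y
      & n <= g (tree_size (e x))].

(* [F] is computable in polynomial time from the tree that encodes its argument
   under [e].  All variables but the first [N] are left alone, so that a caller
   may keep data in them; nothing is assumed of the initial values of the
   others, so that programs can be composed. *)
Definition pt T (e F : T -> tree) :=
  exists c N k, computes e F c N (fun n => n.+2 ^ k).

Lemma pt_intro T (e F : T -> tree) c N g :
  pol g -> computes e F c N g -> pt e F.
Proof.
move=> [k hk] H; exists c, N, k => x s sx.
have [n [s' [h1 h2 h3 h4]]] := H x s sx.
by exists n, s'; split=> //; apply: leq_trans h4 _.
Qed.

Lemma tree_size_gt0 t : 0 < tree_size t. Proof. by case: t. Qed.

Lemma eval_size_cost s e : tree_size (eval s e) <= cost s e.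
Proof. by case: e => *; apply: leq_addr. Qed.

(** The cost of an expression includes the size of its value, so an assignment to variable 0 has
    already paid for the new content. *)
Lemma exec_size0 c s n s' :
  exec c s n s' -> tree_size (s' 0) <= tree_size (s 0) + n.
Proof.
elim=> {c s n s'} //; rewrite ?leq_addr //.
- move=> x e s; rewrite /upd; case: eqP => _; last exact: leq_addr.
  by apply: leq_trans (eval_size_cost s e) _; rewrite leq_addl.
all: intros; lia.
Qed.

(** The time of a second program is measured in the size of its own input; composition therefore
    needs a bound on the output of the first. *)
Lemma pt_size T (e F : T -> tree) : pt e F ->
  exists2 k, 0 < k & forall x, tree_size (F x) <= (tree_size (e x)).+2 ^ k.
Proof.
move=> [c [N [k H]]].
have [l hl] : pol (fun n => n + n.+2 ^ k) by auto with pol.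
exists l.+1 => // x.
have [n [s' [h1 <- _ h4]]] := H x (init (e x)) erefl.
apply: leq_trans (exec_size0 h1) _.
apply: leq_trans (leq_trans (leq_add (leqnn _) h4) (hl _)) _.
by rewrite leq_exp2l.
Qed.

Lemma leq_polexp m n k : m <= n -> m.+2 ^ k <= n.+2 ^ k.
Proof. by move=> h; case: k => // k; rewrite leq_exp2r. Qed.

Lemma eq_pt T (e F G : T -> tree) : (forall x, F x = G x) -> pt e F -> pt e G.
Proof. by move=> /funext ->. Qed.

(** Composition in which the intermediate value [w] only has to exist for each argument. It may live
    in another type under another encoding, as happens when a case analysis uncovers the components
    of a datum. *)
Lemma pt_via T W (e F G : T -> tree) (eW H : W -> tree) :
  pt e F -> pt eW H ->
  (forall x, exists2 w, F x = eW w & G x = H w) -> pt e G.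
Proof.
move=> pF [c2 [N2 [k2 H2]]] hyp; have [l l0 hl] := pt_size pF.
case: pF => c1 [N1 [k1 H1]].
apply: (@pt_intro _ _ _ (CSeq c1 c2) (maxn N1 N2)
  (fun n => n.+2 ^ k1 + (n.+2 ^ l).+2 ^ k2)); first by auto with pol.
move=> x s sx; have [n1 [s1 [a1 b1 d1 e1]]] := H1 x s sx.
have [w Fw Gw] := hyp x.
have [n2 [s2 [a2 b2 d2 e2]]] := H2 w s1 (etrans b1 Fw).
exists (n1 + n2), s2; split.
- exact: exec_seq a1 a2.
- by rewrite b2.
- by move=> y; rewrite geq_max => /andP[y1 y2]; rewrite d2 // d1.
- apply: leq_add e1 (leq_trans e2 _).
  by apply: leq_polexp; rewrite -Fw.
Qed.

Lemma pt_comp T W (e : T -> tree) (eW H : W -> tree) (f : T -> W) :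
  pt eW H -> pt e (fun x => eW (f x)) -> pt e (fun x => H (f x)).
Proof. by move=> pH pf; apply: (pt_via pf pH) => x; exists (f x). Qed.

Lemma pt_id T (e : T -> tree) : pt e e.
Proof.
apply: (@pt_intro _ _ _ (CAssign 0 (EVar 0)) 1 (fun n => n + 0)).
  by auto with pol.
move=> x s sx; exists (cost s (EVar 0)), (upd s 0 (eval s (EVar 0))).
by split=> //=; [exact: exec_assign | case | rewrite sx].
Qed.

Lemma pt_const T (e : T -> tree) t : pt e (fun=> t).
Proof.
(* The constant is written out as a closed expression, whose cost does not depend on the store. *)
pose fix expr_of u := if u is Node l r then ENode (expr_of l) (expr_of r) else ELeaf.
have ev s u : eval s (expr_of u) = u by elim: u => //= l -> r ->.
have co : {c | forall s, cost s (expr_of t) = c}.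
  elim: t => [|l [cl hl] r [cr hr]]; first by exists 1.
  by exists ((tree_size l + tree_size r).+1 + (cl + cr)) => s /=; rewrite !ev hl hr.
case: co => k hk.
apply: (@pt_intro _ _ _ (CAssign 0 (expr_of t)) 1 (fun=> k)); first by auto with pol.
move=> x s sx; exists (cost s (expr_of t)), (upd s 0 (eval s (expr_of t))).
by split=> //=; [exact: exec_assign | rewrite /upd ev | case | rewrite hk].
Qed.

Definition tree_left t := if t is Node l _ then l else Leaf.
Definition tree_right t := if t is Node _ r then r else Leaf.

Lemma pt_left T (e F : T -> tree) : pt e F -> pt e (fun x => tree_left (F x)).
Proof.
move=> pF; apply: (@pt_comp T tree e id tree_left F _ pF) => {T e F pF}.
apply: (@pt_intro _ _ _ (CAssign 0 (ELeft (EVar 0))) 1 (fun n => n + (n + 0))).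
  by auto with pol.
move=> x s sx; exists (cost s (ELeft (EVar 0))), (upd s 0 (eval s (ELeft (EVar 0)))).
split=> //=; [exact: exec_assign | by rewrite /upd /= sx | by case |].
by rewrite sx leq_add //; case: x {sx} => //= l r; lia.
Qed.

Lemma pt_right T (e F : T -> tree) : pt e F -> pt e (fun x => tree_right (F x)).
Proof.
move=> pF; apply: (@pt_comp T tree e id tree_right F _ pF) => {T e F pF}.
apply: (@pt_intro _ _ _ (CAssign 0 (ERight (EVar 0))) 1 (fun n => n + (n + 0))).
  by auto with pol.
move=> x s sx; exists (cost s (ERight (EVar 0))), (upd s 0 (eval s (ERight (EVar 0)))).
split=> //=; [exact: exec_assign | by rewrite /upd /= sx | by case |].
by rewrite sx leq_add //; case: x {sx} => //= l r; lia.
Qed.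

Lemma upd_same (s : store) x t : upd s x t x = t.
Proof. by rewrite /upd eqxx. Qed.

Lemma upd_other (s : store) x y t : y != x -> upd s x t y = s y.
Proof. by rewrite /upd => /negPf ->. Qed.

Lemma pt_node T (e F G : T -> tree) :
  pt e F -> pt e G -> pt e (fun x => Node (F x) (G x)).
Proof.
move=> pF pG; have [l l0 hl] := pt_size pF; have [m m0 hm] := pt_size pG.
case: pF => c1 [N1 [k1 H1]]; case: pG => c2 [N2 [k2 H2]].
(* Variables [N] and [N.+1] are out of reach of both programs: the first saves the input, the second
   the result of [c1]. The successor keeps [N] distinct from variable 0. *)
pose N := (maxn N1 N2).+1.
pose cc := CSeq (CAssign N (EVar 0)) (CSeq c1 (CSeq (CAssign N.+1 (EVar 0))
  (CSeq (CAssign 0 (EVar N)) (CSeq c2 (CAssign 0 (ENode (EVar N.+1) (EVar 0))))))).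
apply: (@pt_intro _ _ _ cc N.+2 (fun n => n + (n.+2 ^ k1 + (n.+2 ^ l + (n +
   (n.+2 ^ k2 + (n.+2 ^ l + n.+2 ^ m + 1 + (n.+2 ^ l + n.+2 ^ m)))))))).
  by repeat (apply: pol_add || exact: pol_exp || exact: pol_id || exact: pol_const).
move=> x s sx.
set s1 := upd s N (s 0).
have [|n1 [s2 [a1 b1 d1 e1]]] := H1 x s1; first by rewrite /s1 upd_other.
set s3 := upd s2 N.+1 (F x).
set s4 := upd s3 0 (e x).
have s3N : s3 N = e x.
  by rewrite /s3 upd_other ?d1 /s1 ?upd_same // /N; lia.
have [|n2 [s5 [a2 b2 d2 e2]]] := H2 x s4; first by rewrite /s4 upd_same.
have s5N : s5 N.+1 = F x.
  by rewrite d2 /s4 ?upd_other /s3 ?upd_same // /N; lia.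
pose r := ENode (EVar N.+1) (EVar 0).
exists (cost s (EVar 0) + (n1 + (cost s2 (EVar 0) + (cost s3 (EVar N) +
  (n2 + cost s5 r))))), (upd s5 0 (eval s5 r)); split.
- apply: exec_seq (exec_assign _ _ _) _.
  apply: exec_seq a1 _.
  apply: exec_seq (exec_assign _ _ _) _; rewrite /= b1 -/s3.
  apply: exec_seq (exec_assign _ _ _) _; rewrite /= s3N -/s4.
  by apply: exec_seq a2 (exec_assign _ _ _).
- by rewrite upd_same /= s5N b2.
- move=> y yN; rewrite upd_other; last by lia.
  rewrite d2; last by rewrite /N in yN; lia.
  rewrite /s4 upd_other ?/s3 ?upd_other ?d1 ?/s1 ?upd_other //; rewrite /N in yN *; lia.
- rewrite /= s5N b1 b2 s3N sx.
  have := hl x; have := hm x; lia.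
Qed.

Lemma tree_eqP t u : reflect (t = u) (tree_eq t u).
Proof.
elim: t u => [|l IHl r IHr] [|l' r'] /=; try by constructor.
by apply: (iffP andP) => [[/IHl -> /IHr ->]|[<- <-]] //; split; [apply/IHl|apply/IHr].
Qed.

Lemma pt_tree_eq T (e F G : T -> tree) :
  pt e F -> pt e G -> pt e (fun x => enc_bool (tree_eq (F x) (G x))).
Proof.
move=> pF pG; have := pt_node pF pG.
pose H (p : tree * tree) := enc_bool (tree_eq p.1 p.2).
move=> pFG; apply: (@pt_via _ (tree * tree) _ _ _ (fun p => Node p.1 p.2) H pFG); last first.
  by move=> x; exists (F x, G x).
pose r := EEq (ELeft (EVar 0)) (ERight (EVar 0)).
apply: (@pt_intro _ _ _ (CAssign 0 r) 1 (fun n => 3 + (n + n + (n + n)))).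
  by auto with pol.
case=> t u s /= sx; exists (cost s r), (upd s 0 (eval s r)); split.
- exact: exec_assign.
- by rewrite upd_same /= sx /H /enc_bool /=.
- by case.
- by rewrite /= sx /=; case: ifP => _ /=; lia.
Qed.

(** Each branch is a program on the subtype of the arguments that lead to it, so that its
    correctness may use the outcome of the test. *)
Lemma pt_branch T (e F G : T -> tree) :
  pt e F ->
  pt (fun x : {x | F x = Leaf} => e (sval x)) (fun x => G (sval x)) ->
  pt (fun x : {x | F x <> Leaf} => e (sval x)) (fun x => G (sval x)) ->
  pt e G.
Proof.
move=> pF; have [l l0 hl] := pt_size pF.
case: pF => c1 [N1 [k1 H1]] [c2 [N2 [k2 H2]]] [c3 [N3 [k3 H3]]].
pose N := (maxn N1 (maxn N2 N3)).+1.
pose cc := CSeq (CAssign N (EVar 0)) (CSeq c1 (CIf (EVar 0)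
  (CSeq (CAssign 0 (EVar N)) c3) (CSeq (CAssign 0 (EVar N)) c2))).
apply: (@pt_intro _ _ _ cc N.+1 (fun n => n + (n.+2 ^ k1 + (n.+2 ^ l + (n +
   (n.+2 ^ k2 + n.+2 ^ k3)))))).
  by repeat (apply: pol_add || exact: pol_exp || exact: pol_id || exact: pol_const).
move=> x s sx.
set s1 := upd s N (s 0).
have [|n1 [s2 [a1 b1 d1 e1]]] := H1 x s1; first by rewrite /s1 upd_other.
have s2N : s2 N = e x by rewrite d1 /s1 ?upd_same // /N; lia.
set s3 := upd s2 0 (e x).
have hl' := hl x.
case: (pselect (F x = Leaf)) => Fx.
- have [|n2 [s4 [a2 b2 d2 e2]]] := H2 (exist _ x Fx) s3; first by rewrite /s3 upd_same.
  exists (cost s (EVar 0) + (n1 + (cost s2 (EVar 0) + (cost s2 (EVar N) + n2)))), s4.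
  split=> //.
  + apply: exec_seq (exec_assign _ _ _) _; apply: exec_seq a1 _.
    apply: exec_if_false; first by rewrite /= b1.
    by apply: exec_seq (exec_assign _ _ _) _; rewrite /= s2N.
  + move=> y yN; rewrite d2 ?/s3 ?upd_other ?d1 ?/s1 ?upd_other //; rewrite /N in yN; lia.
  + rewrite /= in e2; rewrite /= sx b1 s2N; lia.
- have [|n2 [s4 [a2 b2 d2 e2]]] := H3 (exist _ x Fx) s3; first by rewrite /s3 upd_same.
  exists (cost s (EVar 0) + (n1 + (cost s2 (EVar 0) + (cost s2 (EVar N) + n2)))), s4.
  split=> //.
  + apply: exec_seq (exec_assign _ _ _) _; apply: exec_seq a1 _.
    apply: exec_if_true; first by rewrite /= b1.
    by apply: exec_seq (exec_assign _ _ _) _; rewrite /= s2N.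
  + move=> y yN; rewrite d2 ?/s3 ?upd_other ?d1 ?/s1 ?upd_other //; rewrite /N in yN; lia.
  + rewrite /= in e2; rewrite /= sx b1 s2N; lia.
Qed.

(** A polynomial loop body is not enough, since sizes could be multiplied at every round. The
    hypothesis bounds both the number of rounds and the size of every intermediate state in terms of
    the initial state. *)
Lemma pt_while T (e : T -> tree) (b : T -> bool) (g h : T -> T) :
  pt e (fun x => enc_bool (b x)) -> pt e (fun x => e (g x)) ->
  (exists k, forall x, let B := (tree_size (e x)).+2 ^ k in
    exists m, [/\ m <= B, forall i, i < m -> b (iter i g x), ~~ b (iter m g x),
      h x = iter m g x & forall i, i <= m -> tree_size (e (iter i g x)) <= B]) ->
  pt e (fun x => e (h x)).
Proof.
move=> [c1 [N1 [k1 H1]]] [c2 [N2 [k2 H2]]] [k hk].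
pose N := (maxn N1 N2).+1.
(* Between rounds, variable [N] holds the state and variable 0 the value of the test on it. *)
pose body := CSeq (CAssign 0 (EVar N)) (CSeq c2 (CSeq (CAssign N (EVar 0)) c1)).
pose loop := CWhile (EVar 0) body.
(* The time of one round when the states before and after it have size at most [B]; an encoded
   Boolean has size at most 3. *)
pose cost1 B := 3 + (B + (B.+2 ^ k2 + (B + B.+2 ^ k1))).
have size_bool c : tree_size (enc_bool c) <= 3 by case: c.
have loopP B m x s :
    (forall i, i < m -> b (iter i g x)) -> ~~ b (iter m g x) ->
    (forall i, i <= m -> tree_size (e (iter i g x)) <= B) ->
    s N = e x -> s 0 = enc_bool (b x) ->
    exists n s', [/\ exec loop s n s', s' N = e (iter m g x),
      forall y, N < y -> s' y = s y & n <= m * cost1 B + 3].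
  elim: m x s => [|m IH] x s bT bF sB sN s0.
    exists (cost s (EVar 0)), s; split=> //; last by rewrite /= s0 addn0 size_bool.
    by apply: exec_while_false; rewrite /= s0 (negPf bF).
  have bx : b x := bT 0 isT.
  set s1 := upd s 0 (e x).
  have [|n1 [s2 [a1 b1 d1 e1]]] := H2 x s1; first by rewrite /s1 upd_same.
  set s3 := upd s2 N (e (g x)).
  have [|n2 [s4 [a2 b2 d2 e2]]] := H1 (g x) s3; first by rewrite /s3 upd_other.
  have s4N : s4 N = e (g x) by rewrite d2 /s3 ?upd_same // /N; lia.
  have [i im||i im|||n3 [s5 [a3 b3 d3 e3]]] := IH (g x) s4; rewrite -?iterSr //.
  - exact: bT.
  - exact: sB.
  exists (cost s (EVar 0) + (cost s (EVar N) + (n1 + (cost s2 (EVar 0) + n2))) + n3), s5.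
  split=> //.
  - apply: exec_while_true a3; first by rewrite /= s0 bx.
    apply: exec_seq (exec_assign _ _ _) _; rewrite /= sN.
    apply: exec_seq a1 _.
    by apply: exec_seq (exec_assign _ _ _) _; rewrite /= b1.
  - by rewrite iterSr.
  - move=> y yN; rewrite d3 // d2 ?/s3 ?upd_other ?d1 ?/s1 ?upd_other //;
      rewrite /N in yN *; lia.
  - rewrite /= s0 sN b1 !addn0 mulSn /cost1.
    have := size_bool (b x); have := sB 0 isT; have := sB 1 isT => /= B1 B0.
    have := leq_trans e1 (leq_polexp k2 B0); have := leq_trans e2 (leq_polexp k1 B1).
    rewrite /cost1 in e3; lia.
pose cc := CSeq (CAssign N (EVar 0)) (CSeq c1 (CSeq loop (CAssign 0 (EVar N)))).
apply: (@pt_intro _ _ _ cc N.+1 (fun n => n + (n.+2 ^ k1 +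
    (n.+2 ^ k * (3 + (n.+2 ^ k + ((n.+2 ^ k).+2 ^ k2 + (n.+2 ^ k + (n.+2 ^ k).+2 ^ k1))))
     + 3 + n.+2 ^ k)))).
  by repeat (apply: pol_add || apply: pol_mul || exact: pol_exp || exact: pol_id
     || exact: pol_const || exact/pol_comp/pol_exp).
move=> x s sx.
have [m [mB bT bF hx sB]] := hk x.
set s1 := upd s N (s 0).
have [|n1 [s2 [a1 b1 d1 e1]]] := H1 x s1; first by rewrite /s1 upd_other.
have s2N : s2 N = e x by rewrite d1 /s1 ?upd_same // /N; lia.
have [n2 [s3 [a2 b2 d2 e2]]] := loopP _ _ _ _ bT bF sB s2N b1.
exists (cost s (EVar 0) + (n1 + (n2 + cost s3 (EVar N)))), (upd s3 0 (eval s3 (EVar N))).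
split.
- apply: exec_seq (exec_assign _ _ _) _; apply: exec_seq a1 _.
  exact: exec_seq a2 (exec_assign _ _ _).
- by rewrite upd_same /= b2 hx.
- move=> y yN; rewrite upd_other ?d2 ?d1 ?/s1 ?upd_other //; rewrite /N in yN *; lia.
- rewrite /= b2 sx !addn0 leq_add2l.
  apply: leq_add => //; apply: leq_add; last exact: sB.
  by apply: leq_trans e2 _; rewrite leq_add2r leq_mul2r /cost1 mB orbT.
Qed.

(** * Pairs, conditionals and lists *)

Lemma pt_snd T A B (e : T -> tree) (eA : A -> tree) (eB : B -> tree) f :
  pt e (fun x => enc_pair eA eB (f x)) -> pt e (fun x => eB (f x).2).
Proof. by move=> /pt_right. Qed.

Lemma pt_pair T A B (e : T -> tree) (eA : A -> tree) (eB : B -> tree) f g :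
  pt e (fun x => eA (f x)) -> pt e (fun x => eB (g x)) ->
  pt e (fun x => enc_pair eA eB (f x, g x)).
Proof. exact: pt_node. Qed.

Lemma pt_cons T A (e : T -> tree) (eA : A -> tree) f g :
  pt e (fun x => eA (f x)) -> pt e (fun x => enc_seq eA (g x)) ->
  pt e (fun x => enc_seq eA (f x :: g x)).
Proof. exact: pt_node. Qed.

Lemma pt_if T (e : T -> tree) (b : T -> bool) F G :
  pt e (fun x => enc_bool (b x)) -> pt e F -> pt e G ->
  pt e (fun x => if b x then F x else G x).
Proof.
move=> pb pF pG; apply: (pt_branch pb).
- apply: (pt_via (pt_id _) pG) => -[x /=]; case bx: (b x) => // _.
  by exists x; rewrite //= bx.
- apply: (pt_via (pt_id _) pF) => -[x /=]; case bx: (b x) => // _.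
  by exists x; rewrite //= bx.
Qed.

Lemma pt_sval T P (e : T -> tree) F :
  pt e F -> pt (fun x : {x | P x} => e (sval x)) (fun x => F (sval x)).
Proof. by move=> pF; apply: (pt_via (pt_id _) pF) => x; exists (sval x). Qed.

Lemma pt_case_seq T A (e : T -> tree) (eA : A -> tree) l F
    (G : T -> A -> seq A -> tree) :
  pt e (fun x => enc_seq eA (l x)) -> pt e F ->
  pt (enc_pair e (enc_pair eA (enc_seq eA))) (fun p => G p.1 p.2.1 p.2.2) ->
  pt e (fun x => if l x is a :: s then G x a s else F x).
Proof.
move=> pl pF pG; apply: (pt_branch pl).
- apply: (pt_via (pt_id _) pF) => -[x /=]; case lx: (l x) => // _.
  by exists x; rewrite //= lx.
- apply: (@pt_via _ _ _ _ _ _ _ (pt_sval _ (pt_node (pt_id e) pl)) pG).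
  case=> x /=; case lx: (l x) => [|a s] // _.
  by exists (x, (a, s)) => //=; rewrite lx.
Qed.

Lemma pt_eq T (A : eqType) (e : T -> tree) (eA : A -> tree) f g :
  injective eA -> pt e (fun x => eA (f x)) -> pt e (fun x => eA (g x)) ->
  pt e (fun x => enc_bool (f x == g x)).
Proof.
move=> inj pf pg; apply: eq_pt (pt_tree_eq pf pg) => x; congr enc_bool.
by apply/tree_eqP/eqP => [/inj|->].
Qed.

Lemma pt_andb T (e : T -> tree) a b :
  pt e (fun x => enc_bool (a x)) -> pt e (fun x => enc_bool (b x)) ->
  pt e (fun x => enc_bool (a x && b x)).
Proof.
move=> pa pb; apply: (eq_pt _ (pt_if pa pb (pt_const e (enc_bool false)))) => x.
by case: (a x).
Qed.

Lemma pt_orb T (e : T -> tree) a b :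
  pt e (fun x => enc_bool (a x)) -> pt e (fun x => enc_bool (b x)) ->
  pt e (fun x => enc_bool (a x || b x)).
Proof.
move=> pa pb; apply: (eq_pt _ (pt_if pa (pt_const e (enc_bool true)) pb)) => x.
by case: (a x).
Qed.

Lemma pt_negb T (e : T -> tree) a :
  pt e (fun x => enc_bool (a x)) -> pt e (fun x => enc_bool (~~ a x)).
Proof.
move=> pa; apply: (eq_pt _ (pt_if pa (pt_const e (enc_bool false))
  (pt_const e (enc_bool true)))) => x.
by case: (a x).
Qed.

Lemma enc_seq_size T (e : T -> tree) s : size s < tree_size (enc_seq e s).
Proof. by elim: s => //= a s IH; have := tree_size_gt0 (e a); lia. Qed.

(** The end marker of the first list disappears, whence the predecessor. *)
Lemma enc_seq_cat_size T (e : T -> tree) s1 s2 :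
  tree_size (enc_seq e (s1 ++ s2)) =
  (tree_size (enc_seq e s1) + tree_size (enc_seq e s2)).-1.
Proof.
elim: s1 => [|a s IH] /=; first by lia.
by rewrite IH; have := tree_size_gt0 (enc_seq e s); have := tree_size_gt0 (enc_seq e s2); lia.
Qed.

(** A loop whose state consists of the argument, the remaining items and the accumulator. The
    accumulators met on the way are the folds over prefixes of the list, hence the form of the size
    hypothesis. *)
Lemma pt_foldl T A B (e : T -> tree) (eA : A -> tree) (eB : B -> tree) f z l :
  pt (enc_pair e (enc_pair eB eA)) (fun p => eB (f p.1 p.2.1 p.2.2)) ->
  pt e (fun x => eB (z x)) -> pt e (fun x => enc_seq eA (l x)) ->
  (exists k, forall x s1 s2, l x = s1 ++ s2 ->
     tree_size (eB (foldl (f x) (z x) s1)) <= (tree_size (e x)).+2 ^ k) ->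
  pt e (fun x => eB (foldl (f x) (z x) (l x))).
Proof.
move=> pf pz pl [k hk].
have [kl _ hl] := pt_size pl.
(* [(x, i)] stands for the state of the loop after [i] items. *)
pose acc x i := foldl (f x) (z x) (take i (l x)).
pose eS (p : T * nat) := enc_pair (enc_pair e (enc_seq eA)) eB
  (p.1, drop p.2 (l p.1), acc p.1 p.2).
pose b (p : T * nat) := p.2 < size (l p.1).
pose g (p : T * nat) := if b p then (p.1, p.2.+1) else p.
(* In an arbitrary pair the index may lie beyond the end of the list; the loop then does nothing. *)
pose h (p : T * nat) := if b p then (p.1, size (l p.1)) else p.
have pd : pt eS (fun p => enc_seq eA (drop p.2 (l p.1))).
  by apply: (pt_right (pt_left (pt_id eS))).
have ph : pt eS (fun p => eS (h p)).
  apply: (@pt_while _ _ b g).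
  - apply: (eq_pt _ (pt_case_seq (G := fun _ _ _ => enc_bool true) pd
      (pt_const eS (enc_bool false)) (pt_const _ _))) => p.
    rewrite /b; case: ltnP => hp; last by rewrite drop_oversize.
    by have := size_drop p.2 (l p.1); case: drop => //= /eqP; rewrite eq_sym subn_eq0 leqNgt hp.
  - pose G p a s := enc_pair (enc_pair e (enc_seq eA)) eB
      (p.1, s, f p.1 (acc p.1 p.2) a).
    have pG : pt (enc_pair eS (enc_pair eA (enc_seq eA)))
        (fun p => G p.1 p.2.1 p.2.2).
      apply: (pt_node (pt_node _ _)).
      + exact: (pt_left (pt_left (pt_left (pt_id _)))).
      + exact: (pt_right (pt_right (pt_id _))).
      + apply: (pt_comp (f := fun p : T * nat * (A * seq A) =>
          (p.1.1, (acc p.1.1 p.1.2, p.2.1))) pf).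
        apply: (pt_node _ (pt_node _ _)).
        * exact: (pt_left (pt_left (pt_left (pt_id _)))).
        * exact: (pt_right (pt_left (pt_id _))).
        * exact: (pt_left (pt_right (pt_id _))).
    apply: (eq_pt _ (pt_case_seq pd (pt_id eS) pG)) => -[x i].
    rewrite /g /b /=; case: ltnP => hi; last by rewrite drop_oversize.
    case lx: (drop i (l x)) => [|a s].
      by have := size_drop i (l x); rewrite lx /= => /eqP; rewrite eq_sym subn_eq0 leqNgt hi.
    have := drop_nth a hi; rewrite lx => -[ea es].
    by rewrite /G /eS /acc /= (take_nth a hi) foldl_rcons -ea es.
  (* The list and the accumulators are polynomial in the code of [x], which is part of every state,
     so they are polynomial in the size of the state. *)
  - have [K hK] : pol (fun n => n + n.+2 ^ kl + n.+2 ^ k + 2) by auto with pol.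
    exists K => -[x i].
    have it j : j <= size (l x) - i -> iter j g (x, i) = (x, i + j).
      elim: j => [|j IH] hj; first by rewrite addn0.
      by rewrite iterS IH ?(ltnW hj) // /g /b /= addnS -ltn_subRL hj.
    exists (size (l x) - i); split.
    + have h1 := hK (tree_size (eS (x, i))); apply: leq_trans h1.
      have := enc_seq_size eA (l x); have := hl x.
      have : (tree_size (e x)).+2 ^ kl <= (tree_size (eS (x, i))).+2 ^ kl.
        by apply: leq_polexp; rewrite /=; lia.
      lia.
    + by move=> j hj; rewrite it ?(ltnW hj) // /b /= -ltn_subRL.
    + rewrite it // /b /= -leqNgt; lia.
    + rewrite it // /h /b /=; case: ltnP => hi; first by rewrite subnKC // ltnW.
      by congr pair; move: hi; rewrite -subn_eq0 => /eqP ->; rewrite addn0.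
    + move=> j hj; rewrite it //; apply: leq_trans (hK _).
      set n := tree_size (eS (x, i)).
      have h0 : tree_size (e x) <= n by rewrite /n /=; lia.
      have h1 := leq_polexp kl h0; have h2 := leq_polexp k h0.
      have h3 := hk x _ _ (esym (cat_take_drop (i + j) (l x))).
      have h4 := enc_seq_cat_size eA (take (i + j) (l x)) (drop (i + j) (l x)).
      rewrite cat_take_drop in h4.
      have := tree_size_gt0 (enc_seq eA (take (i + j) (l x))).
      have := leq_trans (hl x) h1; have := leq_trans h3 h2.
      set E := tree_size (eS _).
      have -> : E = (tree_size (e x) + tree_size (enc_seq eA (drop (i + j) (l x)))).+2
          + tree_size (eB (acc x (i + j))) by rewrite /E /=; lia.
      rewrite /acc; lia.
have pst : pt e (fun x => eS (x, 0)).
  apply: (pt_node (pt_node (pt_id e) _) _); rewrite /= /acc.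
    by apply: (eq_pt _ pl) => x; rewrite drop0.
  by apply: (eq_pt _ pz) => x; rewrite take0.
apply: (eq_pt _ (pt_right (pt_comp ph pst))) => x.
rewrite /h /b; case: ifP => hx; first by rewrite /eS /acc [tree_right _]/= take_size.
by rewrite /eS /acc [tree_right _]/=; case: (l x) hx.
Qed.

Lemma pt_rev T A (e : T -> tree) (eA : A -> tree) l :
  pt e (fun x => enc_seq eA (l x)) -> pt e (fun x => enc_seq eA (rev (l x))).
Proof.
move=> pl; have revE (s : seq A) : foldl (fun acc a => a :: acc) [::] s = rev s.
  by elim/last_ind: s => // s a IH; rewrite foldl_rcons IH rev_rcons.
have [k _ hk] := pt_size pl.
apply: (eq_pt (fun x => congr1 (enc_seq eA) (revE (l x)))).
apply: (pt_foldl (f := fun x acc a => a :: acc) _ _ pl).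
- apply: pt_cons; first exact: pt_right (pt_right (pt_id _)).
  exact: pt_left (pt_right (pt_id _)).
- exact: pt_const.
- exists k => x s1 s2 lx; apply: leq_trans (hk x); rewrite lx revE.
  elim/last_ind: s1 {lx} => [|s a]; first exact: tree_size_gt0.
  rewrite cat_rcons rev_rcons !enc_seq_cat_size /=.
  have := tree_size_gt0 (enc_seq eA s); have := tree_size_gt0 (enc_seq eA s2); lia.
Qed.

(** Lists are accessible from the front only; a right fold is run as a left fold over the reversed
    list. *)
Lemma pt_foldr T A B (e : T -> tree) (eA : A -> tree) (eB : B -> tree) f z l :
  pt (enc_pair e (enc_pair eA eB)) (fun p => eB (f p.1 p.2.1 p.2.2)) ->
  pt e (fun x => eB (z x)) -> pt e (fun x => enc_seq eA (l x)) ->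
  (exists k, forall x s1 s2, l x = s1 ++ s2 ->
     tree_size (eB (foldr (f x) (z x) s2)) <= (tree_size (e x)).+2 ^ k) ->
  pt e (fun x => eB (foldr (f x) (z x) (l x))).
Proof.
move=> pf pz pl [k hk].
have E x : foldr (f x) (z x) (l x) = foldl (fun b a => f x a b) (z x) (rev (l x)).
  by rewrite foldl_rev.
apply: (eq_pt (fun x => esym (congr1 eB (E x)))).
apply: (pt_foldl (f := fun x b a => f x a b) _ pz (pt_rev pl)).
- apply: (pt_comp (f := fun p : T * (B * A) => (p.1, (p.2.2, p.2.1))) pf).
  apply: (pt_node _ (pt_node _ _)).
  + exact: pt_left (pt_id _).
  + exact: pt_right (pt_right (pt_id _)).
  + exact: pt_left (pt_right (pt_id _)).
- exists k => x s1 s2 rlx.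
  have lx : l x = rev s2 ++ rev s1 by rewrite -rev_cat -rlx revK.
  by have := hk _ _ _ lx; rewrite -foldl_rev revK.
Qed.

(** Each item enlarges the accumulator by an amount that depends on the argument and the item but
    not on the accumulator, so that the growth is additive and the total stays polynomial. *)
Lemma pt_foldr_incr T A B (e : T -> tree) (eA : A -> tree) (eB : B -> tree) f z l :
  pt (enc_pair e (enc_pair eA eB)) (fun p => eB (f p.1 p.2.1 p.2.2)) ->
  pt e (fun x => eB (z x)) -> pt e (fun x => enc_seq eA (l x)) ->
  (exists2 g, pol g & forall x a b,
     tree_size (eB (f x a b)) <= tree_size (eB b) + g (tree_size (e x) + tree_size (eA a))) ->
  pt e (fun x => eB (foldr (f x) (z x) (l x))).
Proof.
move=> pf pz pl [g [k hg] hf]; apply: (pt_foldr pf pz pl).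
have [kl _ hl] := pt_size pl; have [kz _ hz] := pt_size pz.
have [K hK] : pol (fun n => n.+2 ^ kz + n.+2 ^ kl * (n + n.+2 ^ kl).+2 ^ k).
  by auto with pol.
exists K => x s1 s2 lx; apply: leq_trans (hK _).
set n := tree_size (e x).
have bound a : List.In a (l x) -> tree_size (eA a) <= n.+2 ^ kl.
  move=> ain; apply: leq_trans (hl x); elim: (l x) ain => //= a' s IH [->|/IH]; lia.
have hsz : size s2 <= n.+2 ^ kl.
  have := enc_seq_size eA (l x); have := hl x; rewrite lx size_cat -/n; lia.
suff : tree_size (eB (foldr (f x) (z x) s2)) <=
    n.+2 ^ kz + size s2 * (n + n.+2 ^ kl).+2 ^ k.
  by move=> h; apply: leq_trans h _; rewrite leq_add2l leq_mul2r hsz orbT.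
have {}bound a : List.In a s2 -> tree_size (eA a) <= n.+2 ^ kl.
  by move=> ain; apply: bound; rewrite lx; elim: s1 {lx} => //= a' s IH; right.
elim: s2 bound {lx hsz} => [|a s IH] bound /=; first exact: leq_trans (hz x) (leq_addr _ _).
apply: leq_trans (hf _ _ _) _.
have h1 := bound a (or_introl erefl).
have {}IH := IH (fun a h => bound a (or_intror h)).
have h2 : g (n + tree_size (eA a)) <= (n + n.+2 ^ kl).+2 ^ k.
  apply: leq_trans (hg _) (leq_polexp _ _); lia.
rewrite -/n mulSn; lia.
Qed.

Lemma pt_map T A B (e : T -> tree) (eA : A -> tree) (eB : B -> tree) f l :
  pt (enc_pair e eA) (fun p => eB (f p.1 p.2)) ->
  pt e (fun x => enc_seq eA (l x)) ->
  pt e (fun x => enc_seq eB (map (f x) (l x))).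
Proof.
move=> pf pl.
apply: (pt_foldr_incr (f := fun x a s => f x a :: s) (z := fun=> [::]) _ _ pl).
- apply: pt_cons; last exact: pt_right (pt_right (pt_id _)).
  apply: (pt_comp (f := fun p : T * (A * seq B) => (p.1, p.2.1)) pf).
  apply: pt_node; first exact: pt_left (pt_id _).
  exact: pt_left (pt_right (pt_id _)).
- exact: pt_const.
- have [k _ hk] := pt_size pf.
  exists (fun n => 1 + (n + 1).+2 ^ k); first by auto with pol.
  move=> x a b /=; have := hk (x, a); rewrite /= addn1; lia.
Qed.

Lemma pt_cat T A (e : T -> tree) (eA : A -> tree) l1 l2 :
  pt e (fun x => enc_seq eA (l1 x)) -> pt e (fun x => enc_seq eA (l2 x)) ->
  pt e (fun x => enc_seq eA (l1 x ++ l2 x)).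
Proof.
move=> p1 p2.
have E (x : T) : l1 x ++ l2 x = foldr cons (l2 x) (l1 x).
  by elim: (l1 x) => //= a s ->.
apply: (eq_pt (fun x => esym (congr1 (enc_seq eA) (E x)))).
apply: (pt_foldr_incr (f := fun=> cons) _ p2 p1).
- exact: pt_right (pt_id _).
- exists (fun n => n + 1); first by auto with pol.
  by move=> x a b /=; lia.
Qed.

Lemma pt_flatten T A (e : T -> tree) (eA : A -> tree) l :
  pt e (fun x => enc_seq (enc_seq eA) (l x)) ->
  pt e (fun x => enc_seq eA (flatten (l x))).
Proof.
move=> pl; apply: (pt_foldr_incr (f := fun=> cat) (z := fun=> [::]) _ _ pl).
- by apply: pt_cat; [apply: pt_left (pt_right (pt_id _)) | apply: pt_right (pt_right (pt_id _))].
- exact: pt_const.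
- exists id; first exact: pol_id.
  move=> x a b; rewrite enc_seq_cat_size; lia.
Qed.

Lemma pt_filter T A (e : T -> tree) (eA : A -> tree) a l :
  pt (enc_pair e eA) (fun p => enc_bool (a p.1 p.2)) ->
  pt e (fun x => enc_seq eA (l x)) ->
  pt e (fun x => enc_seq eA (filter (a x) (l x))).
Proof.
move=> pa pl.
apply: (pt_foldr_incr (f := fun x y s => if a x y then y :: s else s)
  (z := fun=> [::]) _ _ pl).
- apply: (eq_pt (F := fun p : T * (A * seq A) => if a p.1 p.2.1 then
     enc_seq eA (p.2.1 :: p.2.2) else enc_seq eA p.2.2)); first by move=> p; case: (a _ _).
  apply: pt_if.
  + apply: (pt_comp (f := fun p : T * (A * seq A) => (p.1, p.2.1)) pa).
    apply: pt_node; first exact: pt_left (pt_id _).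
    exact: pt_left (pt_right (pt_id _)).
  + exact: pt_right (pt_id _).
  + exact: pt_right (pt_right (pt_id _)).
- exact: pt_const.
- exists (fun n => n + 1); first by auto with pol.
  by move=> x y s; case: (a x y) => /=; lia.
Qed.

Lemma pt_has T A (e : T -> tree) (eA : A -> tree) a l :
  pt (enc_pair e eA) (fun p => enc_bool (a p.1 p.2)) ->
  pt e (fun x => enc_seq eA (l x)) ->
  pt e (fun x => enc_bool (has (a x) (l x))).
Proof.
move=> pa pl.
have E x : has (a x) (l x) = foldr (fun y b => a x y || b) false (l x) by [].
apply: (pt_foldr_incr (f := fun x y b => a x y || b) (z := fun=> false) _ _ pl).
- apply: pt_orb.
  + apply: (pt_comp (f := fun p : T * (A * bool) => (p.1, p.2.1)) pa).
    apply: pt_node; first exact: pt_left (pt_id _).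
    exact: pt_left (pt_right (pt_id _)).
  + exact: pt_right (pt_right (pt_id _)).
- exact: pt_const.
- exists (fun=> 3); first by auto with pol.
  by move=> x y s; case: (_ || _) => /=; lia.
Qed.

Lemma pt_mem T (A : eqType) (e : T -> tree) (eA : A -> tree) a l :
  injective eA -> pt e (fun x => eA (a x)) -> pt e (fun x => enc_seq eA (l x)) ->
  pt e (fun x => enc_bool (a x \in l x)).
Proof.
move=> inj pa pl; apply: (eq_pt (fun x => congr1 enc_bool (has_pred1 (a x) (l x)))).
apply: (pt_has (a := fun x y => pred1 (a x) y) _ pl).
apply: (pt_eq inj); first exact: pt_right (pt_id _).
by apply: (pt_comp (f := fst) pa); apply: pt_left (pt_id _).
Qed.

Lemma pt_zip T A B (e : T -> tree) (eA : A -> tree) (eB : B -> tree) l1 l2 :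
  pt e (fun x => enc_seq eA (l1 x)) -> pt e (fun x => enc_seq eB (l2 x)) ->
  pt e (fun x => enc_seq (enc_pair eA eB) (zip (l1 x) (l2 x))).
Proof.
move=> p1 p2.
(* The state holds the unread part of the second list and the pairs formed so far, in reverse
   order. *)
pose step (acc : seq B * seq (A * B)) a :=
  if acc.1 is b :: s then (s, (a, b) :: acc.2) else acc.
have E s t u : rev (foldl step (t, u) s).2 = rev u ++ zip s t.
  elim: s t u => [|a r IH] [|b t] u /=; rewrite ?IH ?cats0 //; last by rewrite rev_cons cat_rcons.
  by case: (r); rewrite /= ?cats0.
apply: (eq_pt (fun x => congr1 _ (E (l1 x) (l2 x) [::]))).
apply/pt_rev/pt_snd.
have pz : pt e (fun x => enc_pair (enc_seq eB) (enc_seq (enc_pair eA eB)) (l2 x, [::])).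
  by apply: pt_pair => //; apply: pt_const.
apply: (pt_foldl (f := fun=> step) _ pz p1).
- rewrite /step.
  apply: (eq_pt _ (pt_case_seq (l := fun p : T * (seq B * seq (A * B) * A) => p.2.1.1)
     (G := fun p b s => enc_pair (enc_seq eB) (enc_seq (enc_pair eA eB))
        (s, (p.2.2, b) :: p.2.1.2))
     _ (pt_left (pt_right (pt_id _))) _)).
  + by case=> x [[[|b t] u] a].
  + exact: (pt_left (pt_left (pt_right (pt_id _)))).
  + apply: (pt_node _ (pt_node (pt_node _ _) _)).
    * exact: pt_right (pt_right (pt_id _)).
    * exact: pt_right (pt_right (pt_left (pt_id _))).
    * exact: pt_left (pt_right (pt_id _)).
    * exact: pt_right (pt_left (pt_right (pt_left (pt_id _)))).
- have [k1 _ h1] := pt_size p1; have [kz _ hz] := pt_size pz.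
  have [K hK] : pol (fun n => n.+2 ^ kz + n.+2 ^ k1) by auto with pol.
  exists K => x s1 s2 lx; apply: leq_trans (hK _).
  have := h1 x; have := hz x; rewrite lx enc_seq_cat_size /=.
  have := tree_size_gt0 (enc_seq eA s1); have := tree_size_gt0 (enc_seq eA s2).
  set n := _.+2 ^ kz; set m := _.+2 ^ k1 => g2 g1 ht hs.
  (* The items removed from the two lists pay for the pair that they form, so the total size never
     increases. *)
  suff H t u : tree_size (enc_pair (enc_seq eB) (enc_seq (enc_pair eA eB)) (foldl step (t, u) s1))
    <= tree_size (enc_seq eB t) + tree_size (enc_seq (enc_pair eA eB) u)
       + tree_size (enc_seq eA s1) by have := H (l2 x) [::]; rewrite /=; lia.
  elim: s1 t u {lx hs g1} => [|a s IH] [|b t] u /=; first by lia.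
  + by lia.
  + by apply: leq_trans (IH _ _) _; rewrite /=; lia.
  + by apply: leq_trans (IH _ _) _; rewrite /=; lia.
Qed.

Lemma pt_mask T A (e : T -> tree) (eA : A -> tree) m l :
  pt e (fun x => enc_seq enc_bool (m x)) -> pt e (fun x => enc_seq eA (l x)) ->
  pt e (fun x => enc_seq eA (mask (m x) (l x))).
Proof.
move=> pm pl.
have E (n : bitseq) (s : seq A) : map snd (filter fst (zip n s)) = mask n s.
  by elim: n s => [|[] n IH] [|a s] //=; rewrite ?IH.
apply: (eq_pt (fun x => congr1 _ (E (m x) (l x)))).
apply: (@pt_map _ _ _ e (enc_pair enc_bool eA) eA (fun=> snd)).
  exact: pt_right (pt_right (pt_id _)).
apply: (@pt_filter _ _ e (enc_pair enc_bool eA) (fun=> fst)).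
  exact: pt_left (pt_right (pt_id _)).
exact: pt_zip.
Qed.

(** * Programs on queries *)

Lemma pt_test T (e : T -> tree) t u G :
  pt e t ->
  pt (fun x : {x | t x = u} => e (sval x)) (fun x => G (sval x)) ->
  pt (fun x : {x | t x <> u} => e (sval x)) (fun x => G (sval x)) ->
  pt e G.
Proof.
move=> pt_ pyes pno; apply: (pt_branch (pt_tree_eq pt_ (pt_const e u))).
- apply: (pt_via (pt_id _) pno) => -[x /=]; case: tree_eqP => // tx _.
  by exists (exist _ x tx).
- apply: (pt_via (pt_id _) pyes) => -[x /=]; case: tree_eqP => // tx _.
  by exists (exist _ x tx).
Qed.

Lemma pt_case_query T (e : T -> tree) q GA GE (GC GD : T -> _ -> _ -> tree) GX :
  pt e (fun x => enc_query (q x)) ->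
  pt (enc_pair e (enc_pair enc_name (enc_seq enc_term))) (fun p => GA p.1 p.2.1 p.2.2) ->
  pt (enc_pair e (enc_pair enc_term enc_term)) (fun p => GE p.1 p.2.1 p.2.2) ->
  pt (enc_pair e (enc_pair enc_query enc_query)) (fun p => GC p.1 p.2.1 p.2.2) ->
  pt (enc_pair e (enc_pair enc_query enc_query)) (fun p => GD p.1 p.2.1 p.2.2) ->
  pt (enc_pair e (enc_pair enc_name enc_query)) (fun p => GX p.1 p.2.1 p.2.2) ->
  pt e (fun x => match q x with
    | PAtom r ts => GA x r ts
    | PEq t u => GE x t u
    | PAnd q1 q2 => GC x q1 q2
    | POr q1 q2 => GD x q1 q2
    | PExists y q1 => GX x y q1
    end).
Proof.
move=> pq pA pE pC pD pX.
have pn := pt_node (pt_id e) (pt_right pq).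
(* The constructors are recognised by their tags, one after the other; four negative tests leave the
   quantifier. *)
pose tg n := tree_left (tag n Leaf).
apply: (pt_test (u := tg 0) (pt_left pq)).
  apply: (pt_via (pt_sval _ pn) pA) => -[x /=]; case qx: (q x) => [r ts|t u|q1 q2|q1 q2|y q1] // _.
  by exists (x, (r, ts)); rewrite //= qx.
apply: (pt_test (u := tg 1) (pt_sval _ (pt_left pq))).
  apply: (pt_via (pt_sval _ (pt_sval _ pn)) pE) => -[[x h] /=].
  case qx: (q x) => [r ts|t u|q1 q2|q1 q2|y q1] // _.
  by exists (x, (t, u)); rewrite //= qx.
apply: (pt_test (u := tg 2) (pt_sval _ (pt_sval _ (pt_left pq)))).
  apply: (pt_via (pt_sval _ (pt_sval _ (pt_sval _ pn))) pC) => -[[[x h] h'] /=].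
  case qx: (q x) => [r ts|t u|q1 q2|q1 q2|y q1] // _.
  by exists (x, (q1, q2)); rewrite //= qx.
apply: (pt_test (u := tg 3) (pt_sval _ (pt_sval _ (pt_sval _ (pt_left pq))))).
  apply: (pt_via (pt_sval _ (pt_sval _ (pt_sval _ (pt_sval _ pn)))) pD) => -[[[[x h] h'] h''] /=].
  case qx: (q x) => [r ts|t u|q1 q2|q1 q2|y q1] // _.
  by exists (x, (q1, q2)); rewrite //= qx.
apply: (pt_via (pt_sval _ (pt_sval _ (pt_sval _ (pt_sval _ pn)))) pX).
move=> -[[[[x /= h] /= h'] /= h''] /= h3].
case qx: (q x) => [r ts|t u|q1 q2|q1 q2|y q1].
- by case: h; rewrite qx.
- by case: h'; rewrite qx.
- by case: h''; rewrite qx.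
- by case: h3; rewrite qx.
by exists (x, (y, q1)); rewrite //= qx.
Qed.

Lemma pt_tag T (e F : T -> tree) n : pt e F -> pt e (fun x => tag n (F x)).
Proof. exact: (pt_node (pt_const e (iter n (Node Leaf) Leaf))). Qed.

Definition children q :=
  match q with
  | PAnd q1 q2 | POr q1 q2 => [:: q1; q2]
  | PExists _ q1 => [:: q1]
  | _ => [::]
  end.

(** The nodes of the syntax tree in preorder. The programs have no recursion, so a structural
    recursion over a query becomes a fold over this list. *)
Fixpoint subqueries q :=
  q :: match q with
       | PAnd q1 q2 | POr q1 q2 => subqueries q1 ++ subqueries q2
       | PExists _ q1 => subqueries q1
       | _ => [::]
       end.

Lemma subqueriesE q : subqueries q = q :: flatten (map subqueries (children q)).
Proof. by case: q => //= *; rewrite ?cats0. Qed.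

(** Depth-first traversal with a stack of pending queries: the top one is output and replaced by its
    children. The output is accumulated in reverse. *)
Lemma pt_subqueries T (e : T -> tree) q :
  pt e (fun x => enc_query (q x)) ->
  pt e (fun x => enc_seq enc_query (subqueries (q x))).
Proof.
move=> pq; apply: (@pt_comp _ _ _ _ (fun q => enc_seq enc_query (subqueries q))
  _ _ pq) => {T e q pq}.
pose S : Type := seq pquery * seq pquery.
pose eS : S -> tree := enc_pair (enc_seq enc_query) (enc_seq enc_query).
pose b (p : S) := ~~ nilp p.1.
pose g (p : S) : S := if p.1 is q :: w then (children q ++ w, q :: p.2) else p.
pose h (p : S) : S := ([::], rev (flatten (map subqueries p.1)) ++ p.2).
have p1 : pt eS (fun p => enc_seq enc_query p.1) by apply: pt_left (pt_id eS).
have pg : pt eS (fun p => eS (g p)).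
  apply: (eq_pt _ (pt_case_seq
    (G := fun p q w => eS (children q ++ w, q :: p.2)) p1 (pt_id eS) _)).
    by case=> -[|q w] out.
  pose E := enc_pair eS (enc_pair enc_query (enc_seq enc_query)).
  have pq : pt E (fun p => enc_query p.2.1) by apply: pt_left (pt_right (pt_id _)).
  apply: pt_node; last by apply: pt_cons pq (pt_right (pt_left (pt_id _))).
  apply: pt_cat; last exact: pt_right (pt_right (pt_id _)).

  apply: (eq_pt _ (pt_case_query (GA := fun _ _ _ => Leaf) (GE := fun _ _ _ => Leaf)
    (GC := fun _ q1 q2 => enc_seq enc_query [:: q1; q2])
    (GD := fun _ q1 q2 => enc_seq enc_query [:: q1; q2])
    (GX := fun _ _ q1 => enc_seq enc_query [:: q1]) pq _ _ _ _ _));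
    try exact: pt_const.
  - by move=> p; case: (p.2.1).
  - by apply: pt_node (pt_node _ (pt_const _ _)); [apply: pt_left (pt_right (pt_id _))
      | apply: pt_right (pt_right (pt_id _))].
  - by apply: pt_node (pt_node _ (pt_const _ _)); [apply: pt_left (pt_right (pt_id _))
      | apply: pt_right (pt_right (pt_id _))].
  - by apply: pt_node (pt_const _ _); apply: pt_right (pt_right (pt_id _)).
have ph : pt eS (fun p => eS (h p)).
  apply: (@pt_while _ _ b g _ _ pg).
    apply: (eq_pt _ (pt_case_seq (G := fun _ _ _ => enc_bool true) p1
      (pt_const _ (enc_bool false)) (pt_const _ _))).
    by case=> -[|q w] out.
  pose sz (p : S) := tree_size (enc_seq enc_query p.1).
  (* The code of the stack shrinks at every round, which bounds the number of rounds; the query that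
     is output was on the stack, which bounds the growth of the output. *)
  have step p : b p -> sz (g p) < sz p /\
      tree_size (enc_seq enc_query (g p).2) <= tree_size (enc_seq enc_query p.2) + sz p.
    case: p => -[|q w] out // _; rewrite /sz /g [_.1]/= [_.2]/= enc_seq_cat_size /=.
    by case: q => //= *; split; lia.
  have run n p : sz p <= n -> exists m, [/\ m <= n, forall i, i < m -> b (iter i g p),
      ~~ b (iter m g p), h p = iter m g p & forall i, i <= m ->
        sz (iter i g p) <= sz p /\
        tree_size (enc_seq enc_query (iter i g p).2) <=
          tree_size (enc_seq enc_query p.2) + i * sz p].
    elim: n p => [|n IH] p hp.
      by have := tree_size_gt0 (enc_seq enc_query p.1); rewrite /sz in hp; lia.
    case: (boolP (b p)) => bp; last first.
      exists 0; split=> //; last by case=> //; split; [exact: leqnn | exact: leq_addr].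
      by case: p bp {hp} => -[|q w] out.
    have [h1 h2] := step p bp.
    have [|m [m1 m2 m3 m4 m5]] := IH (g p); first by lia.
    exists m.+1; split; rewrite ?iterSr //.
    - by case=> // i im; rewrite iterSr; apply: m2.
    - rewrite -m4; case: (p) bp => -[|q w] out // _.
      rewrite /h /g [_.1]/= [_.2]/= map_cat flatten_cat /= subqueriesE /=.
      by rewrite rev_cons rev_cat cat_rcons.
    - case=> [|i] im; first by split; [exact: leqnn | exact: leq_addr].
      rewrite iterSr; have [a1 a2] := m5 i im; split; first by lia.
      apply: leq_trans a2 _.
      rewrite mulSn; have : i * sz (g p) <= i * sz p by rewrite leq_mul2l ltnW ?orbT.
      lia.
  have [K hK] : pol (fun n => n + n + n * n + 1) by auto with pol.
  exists K => p B; have [m [m1 m2 m3 m4 m5]] := run _ p (leqnn _).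
  have szp : sz p + tree_size (enc_seq enc_query p.2) < tree_size (eS p) by [].
  have h1 := hK (tree_size (eS p)).
  exists m; split=> //; first by rewrite /B; lia.
  move=> i im; have [a1 a2] := m5 i im.
  apply: leq_trans h1.
  have : i * sz p <= tree_size (eS p) * tree_size (eS p) by apply: leq_mul; lia.
  rewrite [tree_size (eS (iter i g p))]/= -/(sz (iter i g p)); lia.
have pst : pt enc_query (fun q => eS ([:: q], [::])).
  by apply: pt_node (pt_node (pt_id _) (pt_const _ _)) (pt_const _ _).
apply: (eq_pt _ (pt_rev (pt_snd (pt_comp ph pst)))) => q.
by rewrite /h /= !cats0 revK.
Qed.

Fixpoint qmap (h : name -> seq term -> pquery) q :=
  match q with
  | PAtom r ts => h r ts
  | PEq t u => PEq t u
  | PAnd q1 q2 => PAnd (qmap h q1) (qmap h q2)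
  | POr q1 q2 => POr (qmap h q1) (qmap h q2)
  | PExists x q1 => PExists x (qmap h q1)
  end.

(* One step of the evaluation of a query in Polish notation, read from right to
   left. *)
Definition qmap_step (h : name -> seq term -> pquery) q st :=
  match q with
  | PAtom r ts => h r ts :: st
  | PEq t u => PEq t u :: st
  | PAnd _ _ => if st is q1 :: st' then
                  if st' is q2 :: st'' then PAnd q1 q2 :: st'' else [::] else [::]
  | POr _ _ => if st is q1 :: st' then
                 if st' is q2 :: st'' then POr q1 q2 :: st'' else [::] else [::]
  | PExists x _ => if st is q1 :: st' then PExists x q1 :: st' else [::]
  end.

(** When a node is reached from the right, the images of its children are on top of the stack, the
    left one first; the rest of the stack is untouched. *)
Lemma qmap_stepP h q st : foldr (qmap_step h) st (subqueries q) = qmap h q :: st.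
Proof.
by elim: q st => //= [q1 IH1 q2 IH2|q1 IH1 q2 IH2|x q1 IH1] st;
  rewrite ?foldr_cat ?IH2 IH1.
Qed.

Lemma pt_qmap T (e : T -> tree) h q :
  pt (enc_pair e (enc_pair enc_name (enc_seq enc_term)))
    (fun p => enc_query (h p.1 p.2.1 p.2.2)) ->
  pt e (fun x => enc_query (q x)) ->
  pt e (fun x => enc_query (qmap (h x) (q x))).
Proof.
move=> ph pq.
have E x : tree_left (enc_seq enc_query (foldr (qmap_step (h x)) [::] (subqueries (q x)))) =
    enc_query (qmap (h x) (q x)) by rewrite qmap_stepP.
apply: (eq_pt E); apply: pt_left.
apply: (pt_foldr_incr (f := fun x => qmap_step (h x)) (z := fun=> [::])
  _ (pt_const _ _) (pt_subqueries pq)).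
- pose eT := enc_pair e (enc_pair enc_query (enc_seq enc_query)).
  have p1 : pt eT (fun p => enc_query p.2.1) by apply: pt_left (pt_right (pt_id _)).
  pose bin (con : pquery -> pquery -> pquery) st :=
    if st is q1 :: st' then
      if st' is q2 :: st'' then con q1 q2 :: st'' else [::] else [::].
  have pbin n U V (eU : U -> tree) (eV : V -> tree) con :
      (forall q1 q2, enc_query (con q1 q2) = tag n (Node (enc_query q1) (enc_query q2))) ->
      pt (enc_pair eT (enc_pair eU eV)) (fun p => enc_seq enc_query (bin con p.1.2.2)).
    move=> hcon.
    have p2 : pt (enc_pair eT (enc_pair eU eV)) (fun p => enc_seq enc_query p.1.2.2).
      by apply: pt_right (pt_right (pt_left (pt_id _))).
    pose eP := enc_pair (enc_pair eT (enc_pair eU eV)) (enc_pair enc_query (enc_seq enc_query)).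
    have p3 : pt eP (fun p => enc_seq enc_query p.2.2) by apply: pt_right (pt_right (pt_id _)).
    have p4 : pt (enc_pair eP (enc_pair enc_query (enc_seq enc_query))) (fun p =>
        Node (tag n (Node (enc_query p.1.2.1) (enc_query p.2.1))) (enc_seq enc_query p.2.2)).
      apply: pt_node (pt_right (pt_right (pt_id _))).
      apply: pt_tag (pt_node _ (pt_left (pt_right (pt_id _)))).
      exact: pt_left (pt_right (pt_left (pt_id _))).
    pose G q1 q2 st := Node (tag n (Node (enc_query q1) (enc_query q2))) (enc_seq enc_query st).
    have p5 := pt_case_seq (G := fun p => G p.2.1) p3 (pt_const _ Leaf) p4.
    have p6 := pt_case_seq (G := fun _ q1 st => if st is q2 :: st' then G q1 q2 st' else Leaf)
      p2 (pt_const _ Leaf) p5.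
    by apply: (eq_pt _ p6) => -[[x [a [|q1 [|q2 st]]]] uv] //=; rewrite hcon.
  apply: (eq_pt _ (pt_case_query
    (GA := fun p r ts => enc_seq enc_query (h p.1 r ts :: p.2.2))
    (GE := fun p t u => enc_seq enc_query (PEq t u :: p.2.2))
    (GC := fun p _ _ => enc_seq enc_query (bin PAnd p.2.2))
    (GD := fun p _ _ => enc_seq enc_query (bin POr p.2.2))
    (GX := fun p x _ => if p.2.2 is q1 :: st then enc_seq enc_query (PExists x q1 :: st)
       else Leaf) p1 _ _ _ _ _)).
  + by case=> x [[r ts|t u|q1 q2|q1 q2|y q1] [|q3 [|q4 st]]].
  + apply: pt_node (pt_right (pt_right (pt_left (pt_id _)))).
    apply: (pt_comp (f := fun p : T * (pquery * seq pquery) * (name * seq term) =>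
      (p.1.1, p.2)) ph).
    exact: pt_node (pt_left (pt_left (pt_id _))) (pt_right (pt_id _)).
  + apply: pt_node (pt_right (pt_right (pt_left (pt_id _)))).
    exact: pt_tag (pt_right (pt_id _)).
  + exact: (pbin 2).
  + exact: (pbin 3).
  + pose eP := enc_pair eT (enc_pair enc_name enc_query).
    have p2 : pt eP (fun p => enc_seq enc_query p.1.2.2).
      by apply: pt_right (pt_right (pt_left (pt_id _))).
    apply: (pt_case_seq (G := fun p q1 st => enc_seq enc_query (PExists p.2.1 q1 :: st))
      p2 (pt_const _ Leaf)).
    apply: pt_node (pt_right (pt_right (pt_id _))).
    exact: pt_tag (pt_node (pt_left (pt_right (pt_left (pt_id _)))) (pt_left (pt_right (pt_id _)))).
- have [k _ hk] := pt_size ph.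
  (* An atom adds its image and an equality adds itself. A connective adds its tag, a quantifier its
     tag and its variable; 20 is a generous allowance for tags and list nodes. *)
  exists (fun n => (n + n).+2 ^ k + (n + 20)); first by auto with pol.
  move=> x a st; set n := _ + tree_size (enc_query a).
  case: a @n => [r ts|t u|q1 q2|q1 q2|y q1] n /=.
  + have := hk (x, (r, ts)); rewrite /= => h1.
    have : tree_size (enc_query (h x r ts)) <= (n + n).+2 ^ k.
      by apply: leq_trans h1 (leq_polexp _ _); rewrite /n /=; lia.
    lia.
  + rewrite /n /=; lia.
  + by case: st => [|a [|b st]] /=; lia.
  + by case: st => [|a [|b st]] /=; lia.
  + by case: st => [|a st] /=; rewrite /n /=; lia.
Qed.

(** * The reduction *)

(** Domains are tagged as well as relations: through a shared domain, values found in one copy could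
    be bound in dependent accesses to the other. *)
Definition copy_schema (b : bool) (sg : schema) : schema :=
  [seq (b :: e.1, map (cons b) e.2) | e <- sg].
Definition copy_fact (b : bool) (f : fact) : fact := (b :: f.1, f.2).
Definition copy_method (b : bool) (m : method) : method :=
  ((b :: m.1.1, m.1.2), m.2).

Definition two_copies sg := copy_schema true sg ++ copy_schema false sg.
Definition two_method_copies ms :=
  map (copy_method true) ms ++ map (copy_method false) ms.

Definition copy_query b := qmap (fun r => PAtom (b :: r)).

(** A true formula, which positive queries lack as a primitive; it is the empty conjunction. *)
Definition ptrue := PExists [::] (PEq (Var [::]) (Var [::])).
Definition pall (qs : seq pquery) := foldr PAnd ptrue qs.

Definition matches (ts : seq term) (cs : seq name) :=
  pall [seq PEq p.1 (Cst p.2) | p <- zip ts cs].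

(* [f] is added by means of equalities: a relation holding [f] would put the
   values of [f] in the active domain. *)
Definition atom_with (f : fact) r ts :=
  if r == f.1 then POr (PAtom (true :: r) ts) (matches ts f.2)
  else PAtom (true :: r) ts.

(** One variable per attribute, named by the unary strings of length 0, 1, 2 and so on. *)
Definition fresh_vars (ds : seq name) : seq name :=
  foldr (fun _ vs => [::] :: map (cons true) vs) [::] ds.

Definition nonempty r ds :=
  foldr PExists (PAtom (true :: r) (map Var (fresh_vars ds))) (fresh_vars ds).

(* Positive queries lack a false formula; [q] takes its place as the empty
   disjunction, here and in [unlocked].  It will be the right-hand query, which
   may be assumed to fail. *)
Definition domain_inhabited (sg : schema) q d :=
  foldr POr q [seq nonempty e.1 e.2 | e <- sg & d \in e.2].

Definition adom_seq (sg : schema) (C : seq fact) : seq (name * name) :=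
  flatten [seq zip f.2 (doms sg f.1) | f <- C].

Definition brings_new sg C (f : fact) d :=
  has (fun p => (p.2 == d) && (p \notin adom_seq sg C)) (zip f.2 (doms sg f.1)).

(** Novelty is judged against the initial configuration, which the reduction can inspect, instead of
    the configuration reached. *)
Definition unlockable st f m :=
  mdependent m && has (brings_new (sch st) (conf st) f) (input_doms (sch st) m).

Definition inputs_inhabited sg q (f : fact) m :=
  pall [seq domain_inhabited sg q d
       | d <- input_doms sg m & d \notin doms sg f.1].

Definition unlocked st q f :=
  foldr POr q [seq inputs_inhabited (sch st) q f m | m <- acs st & unlockable st f m].

Definition target_setting (st : setting) (f : fact) :=
  Setting (two_copies (sch st)) (two_method_copies (acs st))
    (map (copy_fact true) (conf st) ++ map (copy_fact false) (f :: conf st)).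

Definition target_left st f q :=
  POr (qmap (atom_with f) q)
      (PAnd (copy_query false q) (unlocked st (copy_query true q) f)).

Definition reduction (x : setting * access * pquery) : setting * pquery * pquery :=
  let: (st, a, q) := x in
  let f := (mrel a.1, a.2) in
  (target_setting st f, target_left st f q, copy_query true q).

(** * Running time of the reduction *)

Lemma enc_seq_inj T (e : T -> tree) : injective e -> injective (enc_seq e).
Proof. by move=> inj; elim=> [|a s IH] [|b t] //= [/inj -> /IH ->]. Qed.

Lemma enc_name_inj : injective enc_name.
Proof. by apply: enc_seq_inj => -[] []. Qed.

Lemma pt_weak T A (e : T -> tree) (eA : A -> tree) F :
  pt e F -> pt (enc_pair e eA) (fun p => F p.1).
Proof.
by move=> pF; apply: (@pt_comp _ _ _ _ F fst pF); apply: pt_left (pt_id (enc_pair e eA)).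
Qed.

Lemma pt_last T A (e : T -> tree) (eA : A -> tree) :
  pt (enc_pair e eA) (fun p => eA p.2).
Proof. exact: pt_right (pt_id (enc_pair e eA)). Qed.

Lemma pt_doms T (e : T -> tree) sg r :
  pt e (fun x => enc_schema (sg x)) -> pt e (fun x => enc_name (r x)) ->
  pt e (fun x => enc_seq enc_name (doms (sg x) (r x))).
Proof.
move=> ps pr.
(* A right fold treats the head last, so the first entry for the relation prevails, as it does with
   [index]. *)
have E x : foldr (fun (y : name * seq name) acc => if y.1 == r x then y.2 else acc) [::] (sg x) =
    doms (sg x) (r x).
  rewrite /doms /rels; elim: (sg x) => //= y s ->.
  by case: eqP.
apply: (eq_pt (fun x => congr1 _ (E x))).
pose eS := enc_pair enc_name (enc_seq enc_name).
have ps' : pt e (fun x => enc_seq eS (sg x)) by [].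
apply: (pt_foldr_incr
  (f := fun x (y : name * seq name) acc => if y.1 == r x then y.2 else acc)
  _ (pt_const _ Leaf) ps').
- pose E' := enc_pair e (enc_pair eS (enc_seq enc_name)).
  have p1 : pt E' (fun p => eS p.2.1) by apply: pt_left (pt_last _ _).
  apply: (eq_pt _ (pt_if (pt_eq enc_name_inj (pt_left p1) (pt_weak _ pr)) (pt_right p1)
     (pt_right (pt_last _ _)))).
  by move=> p; case: ifP.
- exists id; first exact: pol_id.
  by move=> x y acc; case: ifP => _ /=; lia.
Qed.

Lemma pt_copy_name T (e : T -> tree) b r :
  pt e (fun x => enc_name (r x)) -> pt e (fun x => enc_name (b :: r x)).
Proof. by move=> pr; apply: pt_cons pr; apply: pt_const. Qed.

Lemma pt_copy_schema T (e : T -> tree) b sg :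
  pt e (fun x => enc_schema (sg x)) -> pt e (fun x => enc_schema (copy_schema b (sg x))).
Proof.
pose eS := enc_pair enc_name (enc_seq enc_name).
move=> ps; apply: (@pt_map _ _ _ e eS eS (fun=> fun y => (b :: y.1, map (cons b) y.2)) _ _ ps).
have p1 := pt_last e eS.
apply: (pt_node (pt_copy_name b (pt_left p1))).
apply: (@pt_map _ _ _ _ enc_name enc_name (fun=> cons b) _ _ (pt_right p1)).
by apply: pt_copy_name; apply: pt_last.
Qed.

Lemma pt_copy_facts T (e : T -> tree) b C :
  pt e (fun x => enc_seq enc_fact (C x)) ->
  pt e (fun x => enc_seq enc_fact (map (copy_fact b) (C x))).
Proof.
move=> pC; apply: (pt_map (f := fun=> copy_fact b) _ pC).
have p1 := pt_last e enc_fact.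
exact: pt_node (pt_copy_name b (pt_left p1)) (pt_right p1).
Qed.

Lemma pt_copy_methods T (e : T -> tree) b l :
  pt e (fun x => enc_seq enc_method (l x)) ->
  pt e (fun x => enc_seq enc_method (map (copy_method b) (l x))).
Proof.
move=> pl; apply: (pt_map (f := fun=> copy_method b) _ pl).
have p1 := pt_last e enc_method.
apply: pt_node (pt_right p1); apply: pt_node (pt_right (pt_left p1)).
by apply: pt_copy_name; apply: pt_left (pt_left p1).
Qed.

Lemma pt_copy_query T (e : T -> tree) b q :
  pt e (fun x => enc_query (q x)) -> pt e (fun x => enc_query (copy_query b (q x))).
Proof.
move=> pq; apply: (pt_qmap (h := fun=> fun r => PAtom (b :: r)) _ pq).
have p1 := pt_last e (enc_pair enc_name (enc_seq enc_term)).
exact: pt_tag 0 (pt_node (pt_copy_name _ (pt_left p1)) (pt_right p1)).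
Qed.

Lemma pt_foldr_query T (e : T -> tree) (con : pquery -> pquery -> pquery) n q l :
  (forall q1 q2, enc_query (con q1 q2) = tag n (Node (enc_query q1) (enc_query q2))) ->
  pt e (fun x => enc_query (q x)) -> pt e (fun x => enc_seq enc_query (l x)) ->
  pt e (fun x => enc_query (foldr con (q x) (l x))).
Proof.
move=> hcon pq pl; apply: (pt_foldr_incr (f := fun=> con) _ pq pl).
- pose E := enc_pair e (enc_pair enc_query enc_query).
  apply: (eq_pt _ (pt_tag n (pt_node (pt_left (pt_last e (enc_pair enc_query enc_query)))
    (pt_right (pt_last _ _))))) => p.
  by rewrite hcon.
- exists (fun m => m + tree_size (tag n (Node Leaf Leaf))); first by auto with pol.
  by move=> x q1 q2; rewrite hcon /=; lia.
Qed.

Lemma pt_pall T (e : T -> tree) l :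
  pt e (fun x => enc_seq enc_query (l x)) -> pt e (fun x => enc_query (pall (l x))).
Proof. exact/(pt_foldr_query (n := 2) _ (pt_const e (enc_query ptrue))). Qed.

Lemma pt_matches T (e : T -> tree) ts cs :
  pt e (fun x => enc_seq enc_term (ts x)) -> pt e (fun x => enc_seq enc_name (cs x)) ->
  pt e (fun x => enc_query (matches (ts x) (cs x))).
Proof.
move=> pts pcs; apply/pt_pall.
apply: (pt_map (f := fun=> fun p => PEq p.1 (Cst p.2)) _ (pt_zip pts pcs)).
have p1 := pt_last e (enc_pair enc_term enc_name).
exact: pt_tag (pt_node (pt_left p1) (pt_tag 1 (pt_right p1))).
Qed.

Lemma pt_qmap_atom_with T (e : T -> tree) f q :
  pt e (fun x => enc_fact (f x)) -> pt e (fun x => enc_query (q x)) ->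
  pt e (fun x => enc_query (qmap (atom_with (f x)) (q x))).
Proof.
move=> pf pq; apply: (pt_qmap (h := fun x => atom_with (f x)) _ pq).
pose eA := enc_pair enc_name (enc_seq enc_term).
have p1 := pt_last e eA; have pf' := pt_weak eA pf.
have pa : pt (enc_pair e eA) (fun p => enc_query (PAtom (true :: p.2.1) p.2.2)).
  exact: pt_tag 0 (pt_node (pt_copy_name _ (pt_left p1)) (pt_right p1)).
have pm := pt_matches (pt_right p1) (pt_right pf').
apply: (eq_pt _ (pt_if (pt_eq enc_name_inj (pt_left p1) (pt_left pf'))
  (pt_tag 3 (pt_node pa pm)) pa)).
by move=> p; rewrite /atom_with; case: ifP.
Qed.

(** Unary names make the total size quadratic; each [true] put in front of a name costs 4. *)
Lemma fresh_vars_size (ds : seq name) :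
  tree_size (enc_seq enc_name (fresh_vars ds)) <= 1 + size ds * (3 * size ds + 3).
Proof.
have size_cons vs : tree_size (enc_seq enc_name (map (cons true) vs)) =
    tree_size (enc_seq enc_name vs) + 4 * size vs.
  by elim: vs => //= v vs ->; lia.
have szE : size (fresh_vars ds) = size ds by elim: ds => //= d ds IH; rewrite size_map IH.
elim: ds szE => //= d ds IH [szE].
rewrite size_cons; rewrite size_map in szE; have := IH szE.
rewrite -/(fresh_vars ds) szE; nia.
Qed.

(** Each step lengthens all the names already in the accumulator, so its growth depends on the
    accumulator and the global size bound is used instead of an additive one. *)
Lemma pt_fresh_vars T (e : T -> tree) ds :
  pt e (fun x => enc_seq enc_name (ds x)) ->
  pt e (fun x => enc_seq enc_name (fresh_vars (ds x))).
Proof.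
move=> pds.
apply: (pt_foldr (f := fun=> fun _ vs => [::] :: map (cons true) vs)
  _ (pt_const _ Leaf) pds).
- have p1 := pt_last e (enc_pair enc_name (enc_seq enc_name)).
  apply: pt_node; first exact: pt_const.
  apply: (@pt_map _ _ _ _ enc_name enc_name (fun=> cons true) _ _ (pt_right p1)).
  by apply: pt_copy_name; apply: pt_last.
- have [k _ hk] := pt_size pds.
  have [K hK] : pol (fun n => 1 + n.+2 ^ k * (3 * n.+2 ^ k + 3)).
    by repeat (apply: pol_add || apply: pol_mul || exact: pol_exp || exact: pol_const).
  exists K => x s1 s2 dx; apply: leq_trans (fresh_vars_size s2) _.
  apply: leq_trans (hK _).
  have : size s2 <= (tree_size (e x)).+2 ^ k.
    apply: leq_trans (hk x); apply: leq_trans (ltnW (enc_seq_size _ _)).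
    by rewrite dx size_cat leq_addl.
  move=> h; rewrite leq_add2l; apply: leq_mul => //; rewrite leq_add2r.
  exact: leq_mul.
Qed.

Lemma pt_nonempty T (e : T -> tree) r ds :
  pt e (fun x => enc_name (r x)) -> pt e (fun x => enc_seq enc_name (ds x)) ->
  pt e (fun x => enc_query (nonempty (r x) (ds x))).
Proof.
move=> pr pds; have pv := pt_fresh_vars pds.
apply: (pt_foldr_incr (f := fun=> PExists) _ _ pv).
- have p1 := pt_last e (enc_pair enc_name enc_query).
  exact: pt_tag (pt_node (pt_left p1) (pt_right p1)).
- apply: pt_tag (pt_node (pt_copy_name _ pr) _).
  apply: (pt_map (f := fun=> Var) _ pv).
  exact: pt_tag 0 (pt_last _ _).
- exists (fun n => n + 12); first by auto with pol.
  by move=> x a b /=; lia.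
Qed.

Lemma pt_domain_inhabited T (e : T -> tree) sg q d :
  pt e (fun x => enc_schema (sg x)) -> pt e (fun x => enc_query (q x)) ->
  pt e (fun x => enc_name (d x)) ->
  pt e (fun x => enc_query (domain_inhabited (sg x) (q x) (d x))).
Proof.
move=> ps pq pd; apply: (@pt_foldr_query _ _ POr 3) => //.
pose eS := enc_pair enc_name (enc_seq enc_name).
have ps' : pt e (fun x => enc_seq eS (sg x)) by [].
apply: (pt_map (f := fun=> fun y : name * seq name => nonempty y.1 y.2)).
  have p1 := pt_last e eS.
  exact: pt_nonempty (pt_left p1) (pt_right p1).
apply: (pt_filter (a := fun x (y : name * seq name) => d x \in y.2) _ ps').
have p1 := pt_last e eS.
exact: pt_mem enc_name_inj (pt_weak eS pd) (pt_right p1).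
Qed.

Lemma pt_adom_seq T (e : T -> tree) sg C :
  pt e (fun x => enc_schema (sg x)) -> pt e (fun x => enc_seq enc_fact (C x)) ->
  pt e (fun x => enc_seq (enc_pair enc_name enc_name) (adom_seq (sg x) (C x))).
Proof.
move=> ps pC; apply/pt_flatten.
apply: (pt_map (f := fun x f => zip f.2 (doms (sg x) f.1)) _ pC).
have p1 := pt_last e enc_fact.
exact: pt_zip (pt_right p1) (pt_doms (pt_weak _ ps) (pt_left p1)).
Qed.

Lemma pt_brings_new T (e : T -> tree) sg C f d :
  pt e (fun x => enc_schema (sg x)) -> pt e (fun x => enc_seq enc_fact (C x)) ->
  pt e (fun x => enc_fact (f x)) -> pt e (fun x => enc_name (d x)) ->
  pt e (fun x => enc_bool (brings_new (sg x) (C x) (f x) (d x))).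
Proof.
move=> ps pC pf pd.
pose eP := enc_pair enc_name enc_name.
have inj : injective eP by move=> [a b] [a' b'] [/enc_name_inj -> /enc_name_inj ->].
apply: (pt_has (a := fun x p => (p.2 == d x) && (p \notin adom_seq (sg x) (C x)))
  _ (pt_zip (pt_right pf) (pt_doms ps (pt_left pf)))).
have p1 := pt_last e eP.
apply: pt_andb; first exact: pt_eq enc_name_inj (pt_right p1) (pt_weak _ pd).
apply/pt_negb/(pt_mem inj p1).
exact: pt_weak (pt_adom_seq ps pC).
Qed.

Lemma pt_input_doms T (e : T -> tree) sg m :
  pt e (fun x => enc_schema (sg x)) -> pt e (fun x => enc_method (m x)) ->
  pt e (fun x => enc_seq enc_name (input_doms (sg x) (m x))).
Proof.
move=> ps pm.
exact: pt_mask (pt_right (pt_left pm)) (pt_doms ps (pt_left (pt_left pm))).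
Qed.

Lemma pt_inputs_inhabited T (e : T -> tree) sg q f m :
  pt e (fun x => enc_schema (sg x)) -> pt e (fun x => enc_query (q x)) ->
  pt e (fun x => enc_fact (f x)) -> pt e (fun x => enc_method (m x)) ->
  pt e (fun x => enc_query (inputs_inhabited (sg x) (q x) (f x) (m x))).
Proof.
move=> ps pq pf pm; apply/pt_pall.
apply: (pt_map (f := fun x => domain_inhabited (sg x) (q x))).
  exact: pt_domain_inhabited (pt_weak _ ps) (pt_weak _ pq) (pt_last _ _).
apply: (pt_filter (a := fun x d => d \notin doms (sg x) (f x).1) _ (pt_input_doms ps pm)).
apply/pt_negb/(pt_mem enc_name_inj (pt_last _ _)).
exact: pt_weak (pt_doms ps (pt_left pf)).
Qed.

Lemma pt_unlocked T (e : T -> tree) st q f :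
  pt e (fun x => enc_setting (st x)) -> pt e (fun x => enc_query (q x)) ->
  pt e (fun x => enc_fact (f x)) ->
  pt e (fun x => enc_query (unlocked (st x) (q x) (f x))).
Proof.
move=> pst pq pf.
have ps : pt e (fun x => enc_schema (sch (st x))) := pt_left pst.
have pa : pt e (fun x => enc_seq enc_method (acs (st x))) := pt_left (pt_right pst).
have pC : pt e (fun x => enc_seq enc_fact (conf (st x))) := pt_right (pt_right pst).
apply: (@pt_foldr_query _ _ POr 3) => //.
have p1 := pt_last e enc_method; have ps1 := pt_weak enc_method ps.
apply: (pt_map (f := fun x => inputs_inhabited (sch (st x)) (q x) (f x))).
  exact: pt_inputs_inhabited ps1 (pt_weak _ pq) (pt_weak _ pf) p1.
apply: (pt_filter (a := fun x => unlockable (st x) (f x)) _ pa).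
apply: pt_andb; first exact: pt_right p1.
apply: (pt_has (a := fun p => brings_new (sch (st p.1)) (conf (st p.1)) (f p.1))
  _ (pt_input_doms ps1 p1)).
exact: pt_brings_new (pt_weak _ ps1) (pt_weak _ (pt_weak _ pC)) (pt_weak _ (pt_weak _ pf))
  (pt_last _ _).
Qed.

Lemma pt_reduction : pt (encode (p := ltr_problem))
  (fun x => encode (p := containment_problem) (reduction x)).
Proof.
pose e := encode (p := ltr_problem).
have pst : pt e (fun x => enc_setting x.1.1) by apply: pt_left (pt_left (pt_id _)).
have pa : pt e (fun x => enc_access x.1.2) by apply: pt_right (pt_left (pt_id _)).
have pq : pt e (fun x => enc_query x.2) by apply: pt_right (pt_id _).
have ps : pt e (fun x => enc_schema (sch x.1.1)) := pt_left pst.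
have pm : pt e (fun x => enc_seq enc_method (acs x.1.1)) := pt_left (pt_right pst).
have pC : pt e (fun x => enc_seq enc_fact (conf x.1.1)) := pt_right (pt_right pst).
have pf : pt e (fun x => enc_fact (mrel x.1.2.1, x.1.2.2)).
  exact: pt_node (pt_left (pt_left (pt_left pa))) (pt_right pa).
have pq1 := pt_copy_query true pq.
apply: (eq_pt (F := fun x => enc_pair (enc_pair enc_setting enc_query) enc_query
  (target_setting x.1.1 (mrel x.1.2.1, x.1.2.2),
   target_left x.1.1 (mrel x.1.2.1, x.1.2.2) x.2, copy_query true x.2))).
  by case=> -[st a] q.
apply: (pt_node _ pq1); apply: pt_node.
  apply: pt_node; last apply: pt_node.
  - exact: pt_cat (pt_copy_schema true ps) (pt_copy_schema false ps).
  - exact: pt_cat (pt_copy_methods true pm) (pt_copy_methods false pm).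
  - exact: pt_cat (pt_copy_facts true pC) (pt_copy_facts false (pt_cons pf pC)).
apply: pt_tag 3 (pt_node (pt_qmap_atom_with pf pq) _).
exact: pt_tag 2 (pt_node (pt_copy_query false pq) (pt_unlocked pst pq1 pf)).
Qed.

Lemma polytime_of_pt (P Q : problem) (f : input P -> input Q) :
  pt (encode (p := P)) (fun x => encode (f x)) -> polytime f.
Proof.
(* The size [t] of the input is positive, hence [t + 2 <= 3 * t] and the time is at most
   [3 ^ k * t ^ k]. A single number has to serve as factor, exponent and additive constant. *)
move=> [c [N [k H]]]; exists c, (3 ^ k + k) => x _.
have [n [s [h1 h2 _ h4]]] := H x (init (encode x)) erefl.
exists n, s; split=> //; apply: leq_trans h4 _.
set t := tree_size _; have t0 : 0 < t by apply: tree_size_gt0.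
apply: leq_trans (leq_addr _ _).
apply: (@leq_trans ((3 * t) ^ k)).
  by case: (k) => // k'; rewrite leq_exp2r //; lia.
rewrite expnMn; apply: leq_mul; first exact: leq_addr.
by rewrite leq_pexp2l // leq_addl.
Qed.

(** * Long-term relevance *)

Local Open Scope classical_set_scope.

(** Positive queries are preserved by homomorphisms that fix their constants, injective or not. *)
Lemma sat_hom (tau : name -> name) D E v q :
  (forall c, c \in consts q -> tau c = c) ->
  (forall r cs, D (r, cs) -> E (r, map tau cs)) ->
  sat D v q -> sat E (tau \o v) q.
Proof.
move=> + hDE; have tv w t : (forall c, c \in tconsts t -> tau c = c) ->
    tval (tau \o w) t = tau (tval w t).
  by case: t => //= c h; rewrite h ?mem_head.
elim: q v => [r ts|t u|q1 IH1 q2 IH2|q1 IH1 q2 IH2|x q IH] v /= hc.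
- move=> /hDE; rewrite -map_comp; congr (E (r, _)).
  elim: ts hc => //= t ts IH hc; rewrite tv; last first.
    by move=> c ct; apply: hc; rewrite mem_cat ct.
  by rewrite IH // => c ct; apply: hc; rewrite mem_cat ct orbT.
- by move=> e; rewrite !tv ?e // => c ct; apply: hc; rewrite mem_cat ct ?orbT.
- by case=> h1 h2; split; [apply: IH1|apply: IH2] => // c cq; apply: hc; rewrite mem_cat cq ?orbT.
- by case=> h; [left; apply: IH1|right; apply: IH2] => // c cq; apply: hc; rewrite mem_cat cq ?orbT.
- case=> c hs; exists (tau c); move: (IH _ hc hs); congr (sat E _ q).
  by apply: funext => y; rewrite /upd /=; case: eqP.
Qed.

Lemma sat_mono D E v q : D `<=` E -> sat D v q -> sat E v q.
Proof.
move=> DE; apply: (sat_hom (tau := id)) => // r cs.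
by rewrite map_id; apply: DE.
Qed.

Lemma holds_mono D E q : D `<=` E -> holds D q -> holds E q.
Proof. by move=> DE h v; apply: sat_mono DE (h v). Qed.

Lemma sat_free_vars D v w q :
  {in free_vars q, v =1 w} -> sat D v q -> sat D w q.
Proof.
have tv t u w' : {in tvars t, u =1 w'} -> tval u t = tval w' t.
  by case: t => //= x h; rewrite h ?mem_head.
elim: q v w => [r ts|t u|q1 IH1 q2 IH2|q1 IH1 q2 IH2|x q IH] v w /= hf.
- congr (D (r, _)); elim: ts hf => //= t ts IH hf; congr cons.
    by apply: tv => y yt; apply: hf; rewrite mem_cat yt.
  by apply: IH => y yt; apply: hf; rewrite mem_cat yt orbT.
- by rewrite (tv t v w) ?(tv u v w) // => y yt; apply: hf; rewrite mem_cat yt ?orbT.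
- by case=> h1 h2; split; [apply: IH1 h1|apply: IH2 h2] => y yt; apply: hf;
    rewrite mem_cat yt ?orbT.
- by case=> h; [left; apply: IH1 h|right; apply: IH2 h] => y yt; apply: hf;
    rewrite mem_cat yt ?orbT.
- case=> c hs; exists c; apply: IH hs => y yq; rewrite /upd; case: eqP => // /eqP yx.
  by apply: hf; rewrite mem_filter yx.
Qed.

Lemma sat_closed D v q : free_vars q = [::] -> sat D v q -> holds D q.
Proof. by move=> fq h w; apply: sat_free_vars h; rewrite fq. Qed.

(** [D] is the least instance consistent with itself, and positive queries are monotone. *)
Lemma certainE sg D q : is_instance sg D -> certain sg D q <-> holds D q.
Proof.
move=> iD; split=> [|h I [_ DI]]; first by apply; split.
exact: holds_mono h.
Qed.

Lemma adom_mono sg D E : D `<=` E -> adom sg D `<=` adom sg E.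
Proof. by move=> DE p [f /DE Ef fp]; exists f. Qed.

Lemma adomU sg D E p : adom sg (D `|` E) p -> adom sg D p \/ adom sg E p.
Proof. by case=> f [Df|Ef] fp; [left|right]; exists f. Qed.

Lemma well_formed_mono sg ms D E a :
  D `<=` E -> well_formed sg ms D a -> well_formed sg ms E a.
Proof. by move=> /(@adom_mono sg) DE [h1 h2 h3]; split=> // /h3 h p /h /DE. Qed.

Lemma path_well_formed_mono sg ms D E p :
  D `<=` E -> path_well_formed sg ms D p -> path_well_formed sg ms E p.
Proof.
elim: p D E => //= s p IH D E DE [h1 h2]; split; first exact: well_formed_mono h1.
by apply: IH h2; apply: setSU.
Qed.

Lemma path_well_formed_cat sg ms D p1 p2 :
  path_well_formed sg ms D (p1 ++ p2) <->
  path_well_formed sg ms D p1 /\ path_well_formed sg ms (final D p1) p2.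
Proof.
elim: p1 D => /= [|s p IH] D; first by split=> // -[].
by rewrite IH; split=> [[? []]|[[]]].
Qed.

Lemma responses_on_cat I p1 p2 :
  responses_on I (p1 ++ p2) <-> responses_on I p1 /\ responses_on I p2.
Proof.
elim: p1 => /= [|s p IH]; first by split=> // -[].
by rewrite IH; split=> [[? []]|[[]]].
Qed.

Lemma final_cat D p1 p2 : final D (p1 ++ p2) = final (final D p1) p2.
Proof. exact: foldl_cat. Qed.

Lemma finalU D X p : final (D `|` X) p = final D p `|` X.
Proof. by elim: p D => [|s p IH] D //=; rewrite setUAC IH. Qed.

Lemma all_id_nseq (m : bitseq) : all id m -> m = nseq (size m) true.
Proof. by elim: m => [|[] m IH] //= /IH <-. Qed.

Section Reach.
Variables (sg : schema) (ms : seq method).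

(** Responses are taken from the instance of all facts of the schema. Since accesses need not be
    exact, enlarging the instance preserves every path, so no instance has to be fixed in
    advance. *)
Inductive reach (C : set fact) : set fact -> Prop :=
| reach_refl : reach C C
| reach_step D a resp :
    reach C D -> well_formed sg ms D a -> is_response (fact_ok sg) a resp ->
    reach C (D `|` resp).

Lemma reach_sub C D : reach C D -> C `<=` D.
Proof. by elim=> // D' a resp _ CD _ _; apply: subset_trans CD _; left. Qed.

Lemma reach_instance C D : is_instance sg C -> reach C D -> is_instance sg D.
Proof. by move=> iC; elim=> // D' a resp _ iD _ hr f [/iD|/hr []]. Qed.

Lemma reach_path C D : reach C D ->
  exists p, [/\ path_well_formed sg ms C p, responses_on (fact_ok sg) p & final C p = D].
Proof.
elim=> [|D' a resp _ [p [h1 h2 h3]] h4 h5]; first by exists [::].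
exists (p ++ [:: (a, resp)]); split; last by rewrite final_cat h3.
- by apply/path_well_formed_cat; rewrite h3.
- exact/responses_on_cat.
Qed.

Lemma path_reach I C p : is_instance sg I ->
  path_well_formed sg ms C p -> responses_on I p -> reach C (final C p).
Proof.
move=> iI; elim/last_ind: p => [|p s IH]; first by move=> *; apply: reach_refl.
rewrite -cats1 => /path_well_formed_cat [h1 [h2 _]] /responses_on_cat [h3 [h4 _]].
rewrite final_cat /=; apply: reach_step (IH h1 h3) h2 _ => f /h4 [If ? ?].
by split=> //; apply: iI.
Qed.

Lemma reachableE C D : is_instance sg C -> reachable sg ms C D <-> reach C D.
Proof.
move=> iC; split=> [[I [p [[iI CI] [h1 h2] ->]]]|/reach_path [p [h1 h2 h3]]].
  exact: path_reach h2.
exists (fact_ok sg), p; split=> //; split=> //; exact: iC.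
Qed.

End Reach.

Section LongTermRelevance.
Variables (st : setting) (a : access) (q : pquery).
Hypotheses (st_ok : setting_ok st) (a_bool : is_boolean a).
Hypothesis a_wf : well_formed (sch st) (acs st) (conf_set st) a.
Let C := conf_set st.
Let f0 : fact := (mrel a.1, a.2).
Let rch := reach (sch st) (acs st).

Lemma conf_instance : is_instance (sch st) C.
Proof. by case: st_ok => _ _ /allP h f /h. Qed.

(** All attributes are inputs, so the binding is the whole tuple; a response is empty or consists of
    [f0]. *)
Lemma access_fact_response f :
  fact_ok (sch st) f -> f.1 = mrel a.1 -> mask (minputs a.1) f.2 = a.2 -> f = f0.
Proof.
case: st_ok => _ /allP ms_ok _; case: a_wf => /ms_ok /andP[_ /eqP sz] _ _.
case: f => r cs /andP[/= _ /eqP hs] hr; rewrite /f0 -{}hr in sz * => <-.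
move: a_bool; rewrite /is_boolean => /all_id_nseq ->.
by rewrite mask_true // sz hs.
Qed.

Lemma access_fact_ok : fact_ok (sch st) f0.
Proof.
case: st_ok => _ /allP ms_ok _; case: a_wf => /ms_ok /andP[h1 /eqP sz] h2 _.
rewrite /fact_ok /= h1 h2 /input_doms; move: a_bool; rewrite /is_boolean => /all_id_nseq ->.
by rewrite mask_true ?eqxx // sz.
Qed.

Lemma access_instance D : is_instance (sch st) D -> is_instance (sch st) (D `|` [set f0]).
Proof. by move=> iD f [/iD|->] //; apply: access_fact_ok. Qed.

Lemma long_term_relevantP : long_term_relevant st a q <->
  exists D, [/\ rch C D, ~ holds D q &
    holds (D `|` [set f0]) q \/
    (exists b, well_formed (sch st) (acs st) (D `|` [set f0]) b /\
               ~ well_formed (sch st) (acs st) D b) /\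
    exists2 E, rch (C `|` [set f0]) E & holds E q].
Proof.
have iC := conf_instance; have iC0 := access_instance iC.
split.
  case=> I [resp [p [p' [[iI CI] [[_ wfp] [respI resps]] [k [-> kp wfk kmax]]]]]] /= cq ncq.
  have [rp1 rp2] : responses_on I (take k p) /\ responses_on I (drop k p).
    by apply/responses_on_cat; rewrite cat_take_drop.
  have rD := path_reach iI wfk rp1; have iD := reach_instance iC rD.
  have nD : ~ holds (final C (take k p)) q by move/(certainE _ iD).
  have resp0 f : resp f -> f = f0.
    by move=> /respI [/iI fok h1 h2]; apply: access_fact_response.
  (* After an empty response nothing is truncated, and both paths end in the same configuration. *)
  have [respf0|nrespf0] := pselect (resp f0); last first.
    have respE : resp = set0.
      by apply/seteqP; split=> // f rf; case: nrespf0; rewrite -(resp0 f).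
    rewrite respE setU0 in cq wfp.
    case: ncq; suff -> : take k p = p by [].
    by rewrite take_oversize // kmax // take_size.
  have respE : resp = [set f0] by apply/seteqP; split=> [f /resp0|f ->].
  rewrite respE in cq wfp; exists (final C (take k p)); split=> //.
  have iE : is_instance (sch st) (final (C `|` [set f0]) p).
    exact: reach_instance iC0 (path_reach iI wfp resps).
  have hE : holds (final (C `|` [set f0]) p) q by apply/(certainE _ iE).
  (* Either the whole of [p] survives the truncation, or the first access cut off is well-formed
     with [f0] and not without it. *)
  case: (leqP (size p) k) => hk.
    by left; rewrite -finalU take_oversize.
  right; split; last by exists (final (C `|` [set f0]) p) => //; apply: path_reach iI wfp resps.
  case dp: (drop k p) => [|s rest].
    by have := size_drop k p; rewrite dp => /eqP; rewrite eq_sym subn_eq0 leqNgt hk.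
  exists s.1; split.
    move: wfp; rewrite -{1}(cat_take_drop k p) => /path_well_formed_cat [_].
    by rewrite dp finalU => -[].
  move=> wfs; have := kmax k.+1 hk; rewrite ltnn => kmax'.
  suff : false by []; apply: kmax'.
  have -> : take k.+1 p = take k p ++ [:: s].
    by rewrite (take_nth s) // cats1; congr rcons; have := drop_nth s hk; rewrite dp => -[].
  by apply/path_well_formed_cat.
case=> D [rD nD hD]; have iD := reach_instance iC rD.
have ncD : ~ certain (sch st) D q by move/(certainE _ iD).
have [p [wfp resps pD]] := reach_path rD.
have respa : is_response (fact_ok (sch st)) a [set f0].
  move=> f ->; split=> //=; first exact: access_fact_ok.
  move: a_bool; rewrite /is_boolean => /all_id_nseq ->; apply: mask_true.
  case: a_wf => _ -> _; rewrite /input_doms size_mask; last first.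
    by case: st_ok => _ /allP ms_ok _; case: a_wf => /ms_ok /andP[_ /eqP].
  by rewrite count_size.
have wfp0 : path_well_formed (sch st) (acs st) (C `|` [set f0]) p.
  by apply: path_well_formed_mono wfp; left.
have iM : consistent (sch st) C (fact_ok (sch st)) by split.
case: hD => [hD|[[b [wfb nwfb]] [E rE hE]]].
  exists (fact_ok (sch st)), [set f0], p, p; split=> //.
  - by exists (size p); split=> //; rewrite ?take_size.
  - by rewrite /= finalU pD; apply/(certainE _ (access_instance iD)).
  - by rewrite pD.
have [p2 [wfp2 resps2 p2E]] := reach_path rE.
(* The access [b] is there to stop the truncated path, so an empty response suffices. The path to
   [E] is then replayed from a larger configuration, where it remains well-formed. *)
pose rest := (b, set0) :: p2.
have CD := reach_sub rD.
exists (fact_ok (sch st)), [set f0], (p ++ rest), p; split=> //.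
- split; split=> //.
    apply/path_well_formed_cat; split=> //=; rewrite finalU pD; split=> //.
    by apply: path_well_formed_mono wfp2; rewrite setU0; apply: setSU.
  by apply/responses_on_cat; split=> //=; split=> //; apply: sub0set.
- exists (size p); split=> //; [by rewrite take_size_cat | by rewrite size_cat leq_addr |].
  move=> j; rewrite size_cat => jp; rewrite take_cat; case: ltnP => [/ltnW //|pj].
  case: (j - size p) (subnKC pj) => [|i]; first by rewrite addn0 => ->.
  by move=> _ /path_well_formed_cat [_ []]; rewrite pD.
- have fE : final (C `|` [set f0]) (p ++ rest) = D `|` [set f0] `|` final set0 p2.
    by rewrite final_cat finalU pD /= setU0 -{1}[D `|` _]set0U finalU setUC.
  have Efin : E `<=` final (C `|` [set f0]) (p ++ rest).
    rewrite fE -p2E -{1}[C `|` _]set0U finalU setUC; apply: setSU; exact: setSU.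
  move=> I [iI DI]; apply: holds_mono hE; exact: subset_trans DI.
- by rewrite pD.
Qed.

End LongTermRelevance.

Lemma zip_map_zip (A B C : eqType) (g : A * B -> C) s t :
  size s = size t ->
  zip (map g (zip s t)) t = map (fun p => (g p, p.2)) (zip s t).
Proof. by elim: s t => [|a s IH] [|b t] //= [/IH ->]. Qed.

Lemma mask_zip (A B : Type) m (s : seq A) (t : seq B) :
  size s = size t -> mask m (zip s t) = zip (mask m s) (mask m t).
Proof. by elim: s t m => [|a s IH] [|b t] [|[] m] //= [/IH ->]. Qed.

Lemma mem_zip2 (A B : eqType) (s : seq A) (t : seq B) b :
  size s = size t -> b \in t -> exists a, (a, b) \in zip s t.
Proof.
elim: s t => [|a s IH] [|b' t] //= [st]; rewrite inE => /orP[/eqP ->|/(IH _ st) [a' h]].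
  by exists a; rewrite mem_head.
by exists a'; rewrite inE h orbT.
Qed.

Lemma zip_mem (A B : eqType) (s : seq A) (t : seq B) p :
  p \in zip s t -> p.1 \in s /\ p.2 \in t.
Proof.
elim: s t => [|a s IH] [|b t] //=; rewrite inE => /orP[/eqP ->|/IH [h1 h2]].
  by rewrite /= !inE !eqxx.
by rewrite !inE h1 h2 !orbT.
Qed.

Lemma mem_adom_seq sg C p : reflect (adom sg [set` C] p) (p \in adom_seq sg C).
Proof.
apply: (iffP flatten_mapP) => [[f fC pf]|[f fC pf]]; by exists f.
Qed.

(** * Renaming new values apart *)

Section Renaming.
Variables (st : setting) (K : seq name).
Hypothesis st_ok : setting_ok st.
Hypothesis confK : forall f, f \in conf st -> {subset f.2 <= K}.
Let sg := sch st.
Let C := conf_set st.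

(** The prefix is longer than any name in [K]: a prefixed name lies outside [K], and its length
    alone tells that the prefix can be stripped. *)
Definition fresh_prefix := nseq (sumn (map size K)).+1 true.

(* Values that do not occur in the initial configuration with the domain at
   hand are renamed to values that do not belong to [K]. *)
Definition rename (p : name * name) : name :=
  if p \in adom_seq sg (conf st) then p.1 else fresh_prefix ++ p.1.

Definition unname (c : name) : name :=
  if sumn (map size K) < size c then drop (size fresh_prefix) c else c.

Definition rename_fact (f : fact) : fact :=
  (f.1, map rename (zip f.2 (doms sg f.1))).

Lemma size_leq_sumn c : c \in K -> size c <= sumn (map size K).
Proof.
elim: K => //= d s IH; rewrite inE => /orP[/eqP ->|/IH h]; first exact: leq_addr.
exact: leq_trans h (leq_addl _ _).
Qed.

Lemma fresh_notin c : fresh_prefix ++ c \notin K.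
Proof.
apply/negP => /size_leq_sumn; rewrite size_cat size_nseq; lia.
Qed.

Lemma unname_id c : c \in K -> unname c = c.
Proof. by move=> /size_leq_sumn; rewrite /unname ltnNge => ->. Qed.

(** [rename] may give a constant two names under two domains; reading a name back does not require
    the domain. *)
Lemma unnameK p : unname (rename p) = p.1.
Proof.
rewrite /rename; case: ifP => [/flatten_mapP [f fC /zip_mem [h _]]|_].
  exact/unname_id/(confK fC).
rewrite /unname size_cat size_nseq ifT; last by lia.
by rewrite drop_size_cat ?size_nseq.
Qed.

Lemma adom_rename D c d : is_instance sg D ->
  adom sg [set rename_fact f | f in D] (c, d) ->
  exists2 c', adom sg D (c', d) & c = rename (c', d).
Proof.
move=> iD [_ [f Df <-]]; have /andP[_ /eqP sz] := iD f Df.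
rewrite /= zip_map_zip // => /mapP [[c' d'] h [-> ->]].
by exists c' => //; exists f.
Qed.

Lemma rename_adom D p : is_instance sg D -> adom sg D p ->
  adom sg [set rename_fact f | f in D] (rename p, p.2).
Proof.
move=> iD [f Df fp]; have /andP[_ /eqP sz] := iD f Df.
exists (rename_fact f); first by exists f.
by rewrite /= zip_map_zip //; apply/mapP; exists p.
Qed.

Lemma rename_conf : [set rename_fact f | f in C] = C.
Proof.
have rid f : C f -> rename_fact f = f.
  move=> fC; have /andP[_ /eqP sz] := conf_instance st_ok fC.
  case: f fC sz => r cs fC /= sz; rewrite /rename_fact /=; congr pair.
  rewrite -[RHS](@unzip1_zip _ _ cs (doms sg r)) ?sz //; apply/eq_in_map => p pz.
  rewrite /rename ifT //; apply/flatten_mapP; by exists (r, cs).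
apply/seteqP; split=> [_ [f fC <-]|f fC]; first by rewrite rid.
by exists f => //; apply: rid.
Qed.

(** Well-formedness of an access concerns pairs of a value and a domain, and [rename] acts on such
    pairs. Renaming bindings and responses together thus turns steps into steps, while the initial
    facts stay fixed. *)
Lemma reach_rename D : reach sg (acs st) C D ->
  reach sg (acs st) C [set rename_fact f | f in D].
Proof.
have iC := conf_instance st_ok.
elim=> [|E a resp rE IH wf hr]; first by rewrite rename_conf; apply: reach_refl.
have iE := reach_instance iC rE.
rewrite image_setU; case: wf => h1 h2 h3.
pose ids := input_doms sg a.1.
apply: (reach_step (a := (a.1, map rename (zip a.2 ids))) IH); first split=> //=.
- by rewrite size_map size_zip h2 minnn.
- move=> dep p; rewrite zip_map_zip // => /mapP [p' /(h3 dep) h ->].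
  exact: rename_adom.
- move=> _ [f rf <-]; have [fok hr1 hr2] := hr f rf; have /andP[h4 /eqP sz] := fok.
  split=> //=.
    by rewrite /fact_ok /= h4 size_map size_zip sz minnn eqxx.
  by rewrite -map_mask mask_zip // hr2 hr1.
Qed.

(** As it may split a constant, [rename] need not induce a homomorphism; [unname] gives one from the
    renamed facts back to [D]. *)
Lemma holds_rename D q : is_instance sg D ->
  {subset consts q <= K} -> free_vars q = [::] ->
  holds [set rename_fact f | f in D] q -> holds D q.
Proof.
move=> iD qK fq h; apply: (sat_closed fq).
apply: (sat_hom (tau := unname) (v := id) _ _ (h id)) => [c /qK /unname_id //|r cs].
move=> [f Df [<- <-]]; have /andP[_ /eqP sz] := iD f Df.
rewrite -map_comp; have -> : map (unname \o rename) (zip f.2 (doms sg f.1)) = f.2.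
  rewrite (eq_map (g := fst)); first by rewrite -/unzip1 unzip1_zip ?sz.
  by move=> p; apply: unnameK.
by rewrite -surjective_pairing.
Qed.

End Renaming.

Section Unlock.
Variables (st : setting) (f0 : fact) (q : pquery).
Hypotheses (st_ok : setting_ok st) (f0_ok : fact_ok (sch st) f0).
Let C := conf_set st.

(** The condition that the query [unlocked] expresses. It is weaker than the existence of an access
    that [f0] makes well-formed at [D], because [D] may already have acquired the new values of
    [f0]; renaming closes the gap. *)
Definition unlocks D := exists m, [/\ m \in acs st, unlockable st f0 m &
  forall d, d \in input_doms (sch st) m -> d \notin doms (sch st) f0.1 ->
    exists c, adom (sch st) D (c, d)].

Lemma unlocks_of_access D b : C `<=` D ->
  well_formed (sch st) (acs st) (D `|` [set f0]) b ->
  ~ well_formed (sch st) (acs st) D b -> unlocks D.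
Proof.
move=> CD [h1 h2 h3] nwf.
have dep : mdependent b.1.
  by apply: contrapT => /negP ndep; apply: nwf; split=> // dep; rewrite dep in ndep.
exists b.1; split=> //.
- rewrite /unlockable dep /=.
  have [p pz np] : exists2 p, p \in zip b.2 (input_doms (sch st) b.1) & ~ adom (sch st) D p.
    apply: contrapT => no; apply: nwf; split=> // _ p pz; apply: contrapT => np.
    by apply: no; exists p.
  (* The value missing from [D] comes from [f0]; it is missing from the initial configuration as
     well, which is smaller. *)
  have /adomU [/np //|[f -> pf]] := h3 dep p pz.
  apply/hasP; exists p.2; first by case/zip_mem: pz.
  apply/hasP; exists p => //; rewrite eqxx /=; apply/mem_adom_seq => h; apply: np.
  exact: adom_mono CD _ h.
- move=> d did dR; have [c cz] := mem_zip2 h2 did.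
  have /adomU [h|[f -> /zip_mem [_ /= dR']]] := h3 dep _ cz; first by exists c.
  by rewrite dR' in dR.
Qed.

Lemma access_of_unlocks D :
  free_vars q = [::] ->
  (forall c, c \in consts q -> exists2 f, f \in conf st & c \in f.2) ->
  reach (sch st) (acs st) C D -> ~ holds D q -> unlocks D ->
  exists D', [/\ reach (sch st) (acs st) C D', ~ holds D' q &
    exists b, well_formed (sch st) (acs st) (D' `|` [set f0]) b /\
              ~ well_formed (sch st) (acs st) D' b].
Proof.
move=> fq qC rD nD [m [mM /andP[dep /hasP[d0 d0m /hasP[p0 p0f /andP[/eqP p0d p0n]]]] hin]].
have iD := reach_instance (conf_instance st_ok) rD.
have /andP[_ /eqP szf] := f0_ok.
(* With the values of [f0] in [K], no renamed value can coincide with one of them. The values of the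
   configuration are in [K] so that [unname] leaves them alone. *)
pose K := f0.2 ++ flatten (map snd (conf st)).
have confK f : f \in conf st -> {subset f.2 <= K}.
  by move=> fC c cf; rewrite mem_cat; apply/orP; right; apply/flatten_mapP; exists f.
have qK : {subset consts q <= K} by move=> c /qC [f fC cf]; apply: (confK f).
pose D' := [set rename_fact st K f | f in D].
have rD' := reach_rename K st_ok rD.
exists D'; split=> //; first by move=> /(holds_rename confK iD qK fq).
have np0 : ~ adom (sch st) D' p0.
  case: p0 p0d p0f p0n => c0 d /= _ p0f p0n /(adom_rename iD) [c' _].
  rewrite /rename; case: ifP => [h e|_ e]; first by rewrite e h in p0n.
  have := fresh_notin K c'; rewrite -e mem_cat.
  by case/zip_mem: p0f => /= ->.
(* A value for each input domain: the new value of [f0] at [d0], some value of [f0] at its other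
   domains, and a value of [D'] elsewhere. *)
have bP d : exists c, d \in input_doms (sch st) m ->
    adom (sch st) (D' `|` [set f0]) (c, d) /\ (d = d0 -> c = p0.1).
  have [->|nd] := eqVneq d d0.
    exists p0.1 => _; split=> //; exists f0; first by right.
    by rewrite -p0d -surjective_pairing.
  have [dm|] := boolP (d \in input_doms (sch st) m); last by exists [::].
  have [/(mem_zip2 szf) [c cz]|dR] := boolP (d \in doms (sch st) f0.1).
    by exists c => _; split=> [|e]; [exists f0 => //; right|rewrite e eqxx in nd].
  have [c /(rename_adom K iD) h] := hin d dm dR.
  exists (rename st K (c, d)) => _; split=> [|e]; last by rewrite e eqxx in nd.
  by apply: adom_mono h; left.
have [b bE] := choice bP.
pose ids := input_doms (sch st) m.
have zE : zip (map b ids) ids = map (fun d => (b d, d)) ids.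
  by rewrite -{2}(map_id ids) zip_map.
exists (m, map b ids); split.
  split=> //=; first by rewrite size_map.
  by move=> _ p; rewrite zE => /mapP [d /bE [h _] ->].
case=> _ _ /(_ dep p0) /= h; apply/np0/h; rewrite zE; apply/mapP; exists d0 => //.
have [_ /(_ erefl) ->] := bE d0 d0m.
by rewrite -p0d -surjective_pairing.
Qed.

End Unlock.

(** * The containment instance *)

Lemma doms_cons (y : name * seq name) sg r :
  doms (y :: sg) r = if y.1 == r then y.2 else doms sg r.
Proof. by rewrite /doms /=; case: eqP. Qed.

Lemma doms_cat sg1 sg2 r :
  doms (sg1 ++ sg2) r = if r \in rels sg1 then doms sg1 r else doms sg2 r.
Proof.
elim: sg1 => //= y sg IH; rewrite !doms_cons IH inE eq_sym.
by case: eqP.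
Qed.

Lemma doms_out sg r : r \notin rels sg -> doms sg r = [::].
Proof.
by elim: sg => //= y sg IH; rewrite doms_cons inE negb_or eq_sym => /andP[/negPf -> /IH].
Qed.

Lemma mem_doms sg e : schema_ok sg -> e \in sg -> doms sg e.1 = e.2.
Proof.
elim: sg => //= y sg IH /andP[ny /IH {}IH]; rewrite doms_cons inE => /orP[/eqP ->|esg].
  by rewrite eqxx.
case: eqP => [ye|_]; last exact: IH.
by case/negP: ny; rewrite ye; apply: map_f.
Qed.

Lemma doms_mem sg r : r \in rels sg -> (r, doms sg r) \in sg.
Proof.
elim: sg => //= -[r' ds] sg IH; rewrite doms_cons !inE /= eq_sym.
by case: eqP => [-> _|_ /=]; [rewrite eqxx | move/IH => ->; rewrite orbT].
Qed.

Section Copy.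
Variables (sg : schema) (ms : seq method).

Local Notation sg2 := (two_copies sg).
Local Notation ms2 := (two_method_copies ms).

Lemma rels_copy b : rels (copy_schema b sg) = map (cons b) (rels sg).
Proof. by rewrite /rels /unzip1 -!map_comp. Qed.

Lemma mem_rels_copies b r : (b :: r \in rels sg2) = (r \in rels sg).
Proof.
have inj (c : bool) : injective (cons c) by move=> ? ? [].
rewrite /rels /unzip1 map_cat mem_cat -!/(unzip1 _) -!/(rels _) !rels_copy.
have no c c' : c != c' -> (c :: r \in map (cons c') (rels sg)) = false.
  by move=> cc; apply/mapP => -[? _ [e _]]; rewrite e eqxx in cc.
by case: b; rewrite (mem_map (inj _)) no ?orbF.
Qed.

Lemma doms_copy b r : doms (copy_schema b sg) (b :: r) = map (cons b) (doms sg r).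
Proof.
elim: (sg) => //= y s IH; rewrite !doms_cons /= IH eqseq_cons eqxx /=.
by case: eqP.
Qed.

Lemma doms_copies b r : doms sg2 (b :: r) = map (cons b) (doms sg r).
Proof.
rewrite doms_cat rels_copy; case: b.
  case: ifP => [_|h]; first exact: doms_copy.
  have nr : r \notin rels sg by apply: contraFN h => /(map_f (cons true)).
  rewrite (doms_out nr) doms_out // rels_copy; apply/negP => /mapP [? _ []] //.
by rewrite ifF ?doms_copy //; apply/mapP => -[? _ []].
Qed.

Lemma rels_copies r : r \in rels sg2 -> exists b r', r = b :: r'.
Proof.
rewrite /rels /unzip1 map_cat mem_cat -!/(unzip1 _) -!/(rels _) !rels_copy.
by case/orP => /mapP [r' _ ->]; [exists true, r'|exists false, r'].
Qed.

Lemma schema_ok_copies : schema_ok sg -> schema_ok sg2.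
Proof.
have inj (c : bool) : injective (cons c) by move=> ? ? [].
rewrite /schema_ok => u.
rewrite /rels /unzip1 map_cat -!/(unzip1 _) -!/(rels _) !rels_copy.
rewrite cat_uniq !(map_inj_uniq (inj _)) u andbT /=.
by apply/hasPn => _ /mapP [r _ ->]; apply/mapP => -[? _ []].
Qed.

Lemma fact_ok_copy b f : fact_ok sg2 (copy_fact b f) = fact_ok sg f.
Proof. by rewrite /fact_ok /= mem_rels_copies doms_copies size_map. Qed.

Definition part b (D : set fact) : set fact := [set f | D (copy_fact b f)].

Lemma partU b D E : part b (D `|` E) = part b D `|` part b E.
Proof. by []. Qed.

Lemma zip_mapr (A B B' : Type) (g : B -> B') (s : seq A) t :
  zip s (map g t) = map (fun p => (p.1, g p.2)) (zip s t).
Proof. by elim: s t => [|a s IH] [|b t] //=; rewrite IH. Qed.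

(** The tag of a domain identifies the copy, so a value can have the domain [b :: d] only through a
    fact of copy [b]. *)
Lemma adom_part D b c d : adom sg2 D (c, b :: d) <-> adom sg (part b D) (c, d).
Proof.
split=> [[[r cs] Df /= pz]|[[r cs] Df /= pz]]; last first.
  exists (b :: r, cs) => //=; rewrite doms_copies zip_mapr; apply/mapP.
  by exists (c, d).
have rin : r \in rels sg2.
  by apply: contraLR pz => /doms_out ->; case: (cs).
have [b' [r' rE]] := rels_copies rin; rewrite {}rE {rin} in Df pz.
rewrite doms_copies zip_mapr in pz; case/mapP: pz => -[c' d'] pz [-> bb ->].
by exists (r', cs) => //; rewrite /part /= bb.
Qed.

Lemma input_doms_copy b m :
  input_doms sg2 (copy_method b m) = map (cons b) (input_doms sg m).
Proof. by rewrite /input_doms /mrel /= doms_copies map_mask. Qed.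

Lemma mem_copies b m : (copy_method b m \in ms2) = (m \in ms).
Proof.
have inj c : injective (copy_method c) by move=> [[r k] e] [[r' k'] e'] [-> -> ->].
have no c c' : c != c' -> (copy_method c m \in map (copy_method c') ms) = false.
  by move=> cc; apply/mapP => -[[[? ?] ?] _ [e]]; rewrite e eqxx in cc.
by rewrite mem_cat; case: b; rewrite (mem_map (inj _)) no ?orbF.
Qed.

Lemma well_formed_copy D b m bd :
  well_formed sg2 ms2 D (copy_method b m, bd) <-> well_formed sg ms (part b D) (m, bd).
Proof.
rewrite /well_formed /= mem_copies input_doms_copy size_map zip_mapr.
split=> -[h1 h2 h3]; split=> // /h3 h.
  by move=> -[c d] cd; apply/adom_part/h/mapP; exists (c, d).
by move=> _ /mapP [[c d] cd ->]; apply/adom_part/h.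
Qed.

(** A step in copy [b] projects to a step, and a step in the other copy leaves the projection
    unchanged. *)
Lemma part_reach C' D' b : reach sg2 ms2 C' D' -> reach sg ms (part b C') (part b D').
Proof.
elim=> [|E [m2 bd] resp _ IH wf hr]; first exact: reach_refl.
have [b' [m mE]] : exists b' m, m2 = copy_method b' m.
  by case: wf; rewrite /= mem_cat => /orP[] /mapP [m _ ->] _ _; [exists true, m|exists false, m].
rewrite {}mE in wf hr; rewrite partU.
have [eb|bb] := eqVneq b' b.
  rewrite {}eb in wf hr; apply: (reach_step (a := (m, bd)) IH).
    exact/well_formed_copy.
  by move=> [r cs] /hr [/=]; rewrite fact_ok_copy => h1 [h2] h3.
suff -> : part b resp = set0 by rewrite setU0.
by apply/seteqP; split=> // f /hr [_ [e]]; rewrite e eqxx in bb.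
Qed.

(** Starting from an arbitrary reachable [E'] allows two uses in succession, one per copy, which
    reach any pair of configurations. *)
Lemma lift_reach b C D C' E' : reach sg ms C D -> reach sg2 ms2 C' E' ->
  C `<=` part b E' ->
  exists F, [/\ reach sg2 ms2 C' F, part b F = part b E' `|` D &
                part (~~ b) F = part (~~ b) E'].
Proof.
move=> + rE CE; elim=> [|D1 [m bd] resp _ [F [rF Fb Fnb]] wf hr].
  by exists E'; split=> //; rewrite (setUidl CE).
pose resp' := [set copy_fact b f | f in resp].
have part_resp : part b resp' = resp.
  apply/seteqP; split=> [f [[r cs] rf [e1 e2]]|f rf]; last by exists f.
  by case: f e1 e2 => r' cs' /= <- <-.
exists (F `|` resp'); split.
- apply: (reach_step (a := (copy_method b m, bd)) rF).
    apply/well_formed_copy/(well_formed_mono _ wf).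
    by rewrite Fb; right.
  move=> _ [f /hr [h1 h2 h3] <-]; split=> //; first by rewrite fact_ok_copy.
  by rewrite /= h2.
- by rewrite partU Fb part_resp setUA.
- rewrite partU Fnb; suff -> : part (~~ b) resp' = set0 by rewrite setU0.
  by apply/seteqP; split=> // f [g _ [e _]]; case: (b) e.
Qed.

End Copy.

(** * Meaning of the queries of the reduction *)

Section Semantics.
Variable sg : schema.

Lemma sat_qmap h D E G q :
  (forall v r ts, r \in rels sg -> size ts = size (doms sg r) ->
     sat D v (h r ts) <-> E (r, map (tval v) ts)) ->
  typed sg G q -> forall v, sat D v (qmap h q) <-> sat E v q.
Proof.
move=> hh; elim: q G => [r ts|t u|q1 IH1 q2 IH2|q1 IH1 q2 IH2|x q IH] G //=.
- by case=> h1 h2 _ v; apply: hh.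
- by case=> /IH1 h1 /IH2 h2 v; rewrite h1 h2.
- by case=> /IH1 h1 /IH2 h2 v; rewrite h1 h2.
- by case=> d /IH {}IH v; split=> -[c /IH hc]; exists c.
Qed.

Lemma sat_copy_query b D G q v : typed sg G q ->
  sat D v (copy_query b q) <-> sat (part b D) v q.
Proof. by move=> tq; apply: (sat_qmap _ tq). Qed.

Lemma sat_ptrue D v : sat D v ptrue.
Proof. by exists [::]. Qed.

Lemma sat_pall (T : eqType) D v (g : T -> pquery) s :
  sat D v (pall (map g s)) <-> forall y, y \in s -> sat D v (g y).
Proof.
elim: s => [|y s IH] /=; first by split=> // _; apply: sat_ptrue.
rewrite IH; split=> [[h1 h2] z|h].
  by rewrite inE => /orP[/eqP ->|/h2].
by split=> [|z zs]; apply: h; rewrite ?mem_head // inE zs orbT.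
Qed.

Lemma sat_any (T : eqType) D v (g : T -> pquery) q s :
  sat D v (foldr POr q (map g s)) <->
  (exists2 y, y \in s & sat D v (g y)) \/ sat D v q.
Proof.
elim: s => [|y s IH] /=; first by split=> [|[[]|]] //; right.
rewrite IH; split=> [[h|[[z zs hz]|h]]|[[z]|h]].
- by left; exists y; rewrite ?mem_head.
- by left; exists z; rewrite // inE zs orbT.
- by right.
- by rewrite inE => /orP[/eqP -> ?|zs hz]; [left | right; left; exists z].
- by right; right.
Qed.

Lemma sat_matches D v ts cs : size ts = size cs ->
  sat D v (matches ts cs) <-> map (tval v) ts = cs.
Proof.
rewrite /matches; elim: ts cs => [|t ts IH] [|c cs] //=.
  by split=> // _; apply: sat_ptrue.
move=> [/IH {}IH]; rewrite -/(pall _) IH; split=> [[-> ->] //|[-> ->]] //.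
Qed.

Lemma sat_atom_with D f G q v : fact_ok sg f -> typed sg G q ->
  sat D v (qmap (atom_with f) q) <-> sat (part true D `|` [set f]) v q.
Proof.
case: f => r' cs' /andP[_ /eqP /= szf] tq; apply: (sat_qmap _ tq) => w r ts _ sz.
rewrite /atom_with /=; case: eqP => rr /=.
  rewrite sat_matches ?szf ?sz rr //.
  by split=> [[h|->]|[h|[<-]]]; [left | right | left | right].
by split=> [h|[h|[e _]]]; [left | exact: h | case: rr].
Qed.

Lemma size_fresh_vars (ds : seq name) : size (fresh_vars ds) = size ds.
Proof. by elim: ds => //= d ds IH; rewrite size_map IH. Qed.

Lemma uniq_fresh_vars (ds : seq name) : uniq (fresh_vars ds).
Proof.
elim: ds => //= d ds IH; rewrite map_inj_uniq => [|? ? []] //; rewrite IH andbT.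
by apply/mapP => -[].
Qed.

Lemma sat_exists_all D v q xs : sat D v (foldr PExists q xs) <->
  exists w, sat D (fun x => if x \in xs then w x else v x) q.
Proof.
elim: xs v => [|x xs IH] v /=; first by split=> [h|[]//]; exists v.
split=> [[c /IH [w hw]]|[w hw]].
  (* If [x] occurs again in [xs], the inner quantifier decides its value. *)
  exists (fun y => if y \in xs then w y else if y == x then c else v y).
  move: hw; congr (sat D _ q); apply: funext => y; rewrite inE /upd.
  by case: (y \in xs); case: eqP.
exists (w x); apply/IH; exists w; move: hw; congr (sat D _ q).
apply: funext => y; rewrite inE /upd; case: (y \in xs); rewrite ?orbT ?orbF //.
by case: eqP => // ->.
Qed.

Lemma sat_nonempty D v r ds : sat D v (nonempty r ds) <->
  exists2 cs, size cs = size ds & D (true :: r, cs).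
Proof.
rewrite /nonempty sat_exists_all /=; split=> [[w h]|[cs sz h]].
  by eexists; last exact: h; rewrite !size_map size_fresh_vars.
exists (fun x => nth [::] cs (index x (fresh_vars ds))).
move: h; congr (D (_, _)); rewrite -map_comp.
apply: (@eq_from_nth _ [::]); first by rewrite size_map size_fresh_vars.
move=> i; rewrite sz => hi; rewrite (nth_map [::]) ?size_fresh_vars //=.
by rewrite mem_nth ?index_uniq ?size_fresh_vars // uniq_fresh_vars.
Qed.

Lemma sat_domain_inhabited D v q d : schema_ok sg -> is_instance sg (part true D) ->
  ~ sat D v q ->
  sat D v (domain_inhabited sg q d) <-> exists c, adom sg (part true D) (c, d).
Proof.
move=> sok iD nq; rewrite (sat_any _ _ (fun e : name * seq name => nonempty e.1 e.2)).
split=> [[[[r ds]]|//]|[c [[r cs] Df pz]]].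
  rewrite mem_filter => /andP[/= dds esg] /sat_nonempty [cs sz h].
  have [c cz] := mem_zip2 sz dds; exists c, (r, cs) => //=.
  by rewrite (mem_doms sok esg).
have /andP[/= rin /eqP sz] := iD _ Df.
left; exists (r, doms sg r).
  by rewrite mem_filter doms_mem // andbT; case: (zip_mem pz).
by apply/sat_nonempty; exists cs.
Qed.

End Semantics.

Lemma sat_unlocked st f0 q D v : setting_ok st -> is_instance (sch st) (part true D) ->
  ~ sat D v q ->
  sat D v (unlocked st q f0) <-> unlocks st f0 (part true D).
Proof.
move=> [sok _ _] iD nq; rewrite sat_any; split.
  case=> [[m]|//]; rewrite mem_filter => /andP[um mM] /sat_pall h.
  exists m; split=> // d dm dR; apply/(sat_domain_inhabited _ sok iD nq)/h.
  by rewrite mem_filter dR.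
case=> m [mM um h]; left; exists m; first by rewrite mem_filter um.
apply/sat_pall => d; rewrite mem_filter => /andP[dR dm].
exact/(sat_domain_inhabited _ sok iD nq)/h.
Qed.

(** * Validity of the containment instance *)

Lemma typed_free_vars sg G H q :
  {in free_vars q, G =1 H} -> typed sg G q -> typed sg H q.
Proof.
have tt t d K L : {in tvars t, K =1 L} -> term_typed K t d -> term_typed L t d.
  by case: t => //= x h; rewrite h ?mem_head.
elim: q G H => [r ts|t u|q1 IH1 q2 IH2|q1 IH1 q2 IH2|x q IH] G H /= hf.
- case=> h1 h2 h3; split=> //; move: h3; elim: ts (doms sg r) hf {h2} => [|t ts IH] [|d ds] //= hf.
  case/andP=> h3 h4; apply/andP; split.
    by apply: tt h3 => y yt; apply: hf; rewrite mem_cat yt.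
  by apply: IH h4 => y yt; apply: hf; rewrite mem_cat yt orbT.
- case=> d /andP[h1 h2]; exists d; apply/andP.
  by split; [apply: tt h1|apply: tt h2] => y yt; apply: hf; rewrite mem_cat yt ?orbT.
- by case=> h1 h2; split; [apply: IH1 h1|apply: IH2 h2] => y yt; apply: hf;
    rewrite mem_cat yt ?orbT.
- by case=> h1 h2; split; [apply: IH1 h1|apply: IH2 h2] => y yt; apply: hf;
    rewrite mem_cat yt ?orbT.
- case=> d hs; exists d; apply: IH hs => y yq; rewrite /upd; case: eqP => // /eqP yx.
  by apply: hf; rewrite mem_filter yx.
Qed.

(** For a closed query, being typed under some assignment or under all of them is the same. The
    universal form passes to conjunctions and disjunctions without any matching of assignments. *)
Definition sentence_ok sg (P : name -> Prop) q :=
  [/\ free_vars q = [::], forall G, typed sg G q & forall c, c \in consts q -> P c].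

Lemma query_okE sg C q :
  query_ok sg C q <-> sentence_ok sg (fun c => exists2 f, f \in C & c \in f.2) q.
Proof.
split=> [[h1 [G h2] h3]|[h1 h2 h3]]; last by split=> //; exists id.
by split=> // H; apply: typed_free_vars h2; rewrite h1.
Qed.

Section SentenceOk.
Variables (sg : schema) (P : name -> Prop).

Lemma sentence_ok_or q1 q2 :
  sentence_ok sg P q1 -> sentence_ok sg P q2 -> sentence_ok sg P (POr q1 q2).
Proof.
move=> [a1 b1 c1] [a2 b2 c2]; split=> /= [|G|c]; rewrite ?a1 ?a2 //.
by rewrite mem_cat => /orP[/c1|/c2].
Qed.

Lemma sentence_ok_and q1 q2 :
  sentence_ok sg P q1 -> sentence_ok sg P q2 -> sentence_ok sg P (PAnd q1 q2).
Proof. exact: sentence_ok_or. Qed.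

Lemma sentence_ok_any (T : eqType) (g : T -> pquery) q s : sentence_ok sg P q ->
  (forall y, y \in s -> sentence_ok sg P (g y)) ->
  sentence_ok sg P (foldr POr q (map g s)).
Proof.
move=> qok; elim: s => //= y s IH h; apply: sentence_ok_or; first by apply: h; rewrite mem_head.
by apply: IH => z zs; apply: h; rewrite inE zs orbT.
Qed.

Lemma sentence_ok_all (T : eqType) (g : T -> pquery) s :
  (forall y, y \in s -> sentence_ok sg P (g y)) -> sentence_ok sg P (pall (map g s)).
Proof.
elim: s => [|y s IH] h /=.
  by split=> // G; exists [::]; exists [::]; rewrite /= /upd eqxx.
apply: sentence_ok_and; first by apply: h; rewrite mem_head.
by apply: IH => z zs; apply: h; rewrite inE zs orbT.
Qed.

End SentenceOk.

Lemma free_vars_qmap h q :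
  (forall r ts, {subset free_vars (h r ts) <= flatten (map tvars ts)}) ->
  {subset free_vars (qmap h q) <= free_vars q}.
Proof.
move=> hh; elim: q => [r ts|t u|q1 IH1 q2 IH2|q1 IH1 q2 IH2|x q IH] y //=; first exact: hh.
- by rewrite !mem_cat => /orP[/IH1 ->|/IH2 ->]; rewrite ?orbT.
- by rewrite !mem_cat => /orP[/IH1 ->|/IH2 ->]; rewrite ?orbT.
- by rewrite !mem_filter => /andP[-> /IH].
Qed.

Lemma consts_qmap (P : name -> Prop) h q :
  (forall r ts c, c \in consts (h r ts) -> c \in flatten (map tconsts ts) \/ P c) ->
  forall c, c \in consts (qmap h q) -> c \in consts q \/ P c.
Proof.
move=> hh; elim: q => [r ts|t u|q1 IH1 q2 IH2|q1 IH1 q2 IH2|x q IH] c //=.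
- exact: hh.
- by left.
- by rewrite !mem_cat => /orP[/IH1|/IH2] [->|]; rewrite ?orbT; [left|right|left|right].
- by rewrite !mem_cat => /orP[/IH1|/IH2] [->|]; rewrite ?orbT; [left|right|left|right].
- exact: IH.
Qed.

Lemma typed_qmap sg sg' b h G q :
  (forall G r ts, typed sg G (PAtom r ts) -> typed sg' (cons b \o G) (h r ts)) ->
  typed sg G q -> typed sg' (cons b \o G) (qmap h q).
Proof.
move=> hh; elim: q G => [r ts|t u|q1 IH1 q2 IH2|q1 IH1 q2 IH2|x q IH] G /=.
- exact: hh.
- case=> d /andP[h1 h2]; exists (b :: d).
  by apply/andP; split; [case: t h1|case: u h2] => //= x /eqP ->.
- by case=> /IH1 ? /IH2.
- by case=> /IH1 ? /IH2.
- case=> d /IH h1; exists (b :: d); move: h1; congr (typed _ _ _).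
  by apply: funext => y; rewrite /upd /=; case: eqP.
Qed.

Lemma typed_copy_atom sg b G r ts :
  typed sg G (PAtom r ts) -> typed (two_copies sg) (cons b \o G) (PAtom (b :: r) ts).
Proof.
case=> h1 h2 h3; split; rewrite ?mem_rels_copies ?doms_copies ?size_map //.
move: h3; rewrite zip_mapr all_map; apply: sub_all => -[t d] /=.
by case: t => //= x /eqP ->.
Qed.

Lemma subset_nil (T : eqType) (s : seq T) : {subset s <= [::]} -> s = [::].
Proof. by case: s => // x s /(_ x (mem_head _ _)). Qed.

Lemma sentence_ok_copy sg P b q : sentence_ok sg P q ->
  sentence_ok (two_copies sg) P (copy_query b q).
Proof.
case=> fq tq cq.
have fq' : free_vars (copy_query b q) = [::].
  apply: subset_nil; rewrite -fq.
  by apply: (@free_vars_qmap (fun r => PAtom (b :: r))) => r ts y.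
split=> // [G|].
(* The query being closed, typing it under one assignment is enough. *)
- apply: (@typed_free_vars _ (cons b \o id)); first by rewrite fq'.
  apply: (@typed_qmap sg _ b _ id q _ (tq id)) => H r ts h.
  exact: typed_copy_atom.
- move=> c /(consts_qmap (P := P)) [] //; last exact: cq.
  by move=> *; left.
Qed.

Lemma free_vars_matches ts cs : {subset free_vars (matches ts cs) <= flatten (map tvars ts)}.
Proof.
elim: ts cs => [|t ts IH] [|c cs] //= y; rewrite -/(matches ts cs) cats0 !mem_cat.
by case/orP => [->|/IH ->]; rewrite ?orbT.
Qed.

Lemma consts_matches ts cs c : c \in consts (matches ts cs) ->
  c \in flatten (map tconsts ts) \/ c \in cs.
Proof.
elim: ts cs => [|t ts IH] [|d cs] //=; rewrite -/(matches ts cs) !mem_cat !inE.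
case/orP => [/orP[->|->]|/IH [->|->]]; rewrite ?orbT; by [left|right].
Qed.

Lemma typed_matches sg G ts cs : typed sg G (matches ts cs).
Proof.
elim: ts cs => [|t ts IH] [|c cs] /=; try by exists [::], [::]; rewrite /= /upd eqxx.
split; last exact: IH.
by case: t => [x|d]; [exists (G x); rewrite /= eqxx | exists [::]].
Qed.

Lemma sentence_ok_atom_with sg (P : name -> Prop) f q : sentence_ok sg P q ->
  (forall c, c \in f.2 -> P c) -> sentence_ok (two_copies sg) P (qmap (atom_with f) q).
Proof.
case=> fq tq cq fP.
have hf r ts : {subset free_vars (atom_with f r ts) <= flatten (map tvars ts)}.
  rewrite /atom_with; case: ifP => _ y /=; last by [].
  rewrite mem_cat => /orP[//|].
  exact: free_vars_matches.
have fq' : free_vars (qmap (atom_with f) q) = [::].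
  by apply: subset_nil; rewrite -fq; apply: free_vars_qmap.
split=> // [G|c].
- apply: (@typed_free_vars _ (cons true \o id)); first by rewrite fq'.
  apply: (@typed_qmap sg _ true _ id q _ (tq id)) => H r ts /(typed_copy_atom true) h.
  by rewrite /atom_with; case: ifP => //; split=> //; apply: typed_matches.
- move=> /(consts_qmap (P := P)) [|/cq //|//] r ts d.
  rewrite /atom_with; case: ifP => /= _; last by left.
  rewrite mem_cat => /orP[|/consts_matches [|/fP]]; by [left|right].
Qed.

Lemma typed_exists_all sg G H q xs :
  typed sg (fun x => if x \in xs then H x else G x) q -> typed sg G (foldr PExists q xs).
Proof.
elim: xs G => //= x xs IH G h; exists (H x); apply: IH; move: h; congr (typed _ _ _).
apply: funext => y; rewrite inE /upd; case: (y \in xs); rewrite ?orbT ?orbF //.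
by case: eqP => // ->.
Qed.

Lemma free_vars_exists_all q xs :
  free_vars (foldr PExists q xs) = [seq x <- free_vars q | x \notin xs].
Proof.
elim: xs => [|x xs IH] /=; first by rewrite filter_predT.
by rewrite IH -filter_predI; apply: eq_filter => y; rewrite /= inE negb_or.
Qed.

Lemma consts_exists_all q xs : consts (foldr PExists q xs) = consts q.
Proof. by elim: xs. Qed.

Lemma sentence_ok_nonempty sg P r ds : r \in rels sg -> doms sg r = ds ->
  sentence_ok (two_copies sg) P (nonempty r ds).
Proof.
move=> rin dr; rewrite /nonempty; split.
- have vE (xs : seq name) : flatten (map tvars (map Var xs)) = xs by elim: xs => //= x xs ->.
  rewrite free_vars_exists_all /= vE; apply: subset_nil => y.
  by rewrite mem_filter => /andP[/negPf ->].
(* Each variable gets the tagged domain of the attribute at its own position. *)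
- move=> G; pose H x := true :: nth [::] ds (index x (fresh_vars ds)).
  apply: (@typed_exists_all _ _ H) => /=.
  rewrite mem_rels_copies doms_copies dr !size_map size_fresh_vars; split=> //.
  rewrite zip_mapr all_map; apply/(all_nthP (Var [::], [::])) => i.
  rewrite size_zip size_map size_fresh_vars minnn => hi.
  rewrite nth_zip ?size_map ?size_fresh_vars //= (nth_map [::]) ?size_fresh_vars //=.
  by rewrite mem_nth ?size_fresh_vars // /H index_uniq ?size_fresh_vars ?uniq_fresh_vars.
- by rewrite consts_exists_all /=; elim: (fresh_vars ds).
Qed.

Lemma sentence_ok_unlocked st P f q : schema_ok (sch st) ->
  sentence_ok (two_copies (sch st)) P q ->
  sentence_ok (two_copies (sch st)) P (unlocked st q f).
Proof.
move=> sok qok; apply: (sentence_ok_any qok) => m _; apply: sentence_ok_all => d _.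
apply: (sentence_ok_any (g := fun e : name * seq name => nonempty e.1 e.2) qok) => e.
rewrite mem_filter => /andP[_ esg].
by apply: sentence_ok_nonempty; [apply: map_f | apply: mem_doms].
Qed.

Lemma valid_reduction x :
  valid (p := ltr_problem) x -> valid (p := containment_problem) (reduction x).
Proof.
case: x => -[st a] q [st_ok ab wfa /query_okE qok].
have f0_ok := access_fact_ok st_ok ab wfa.
set f0 := (mrel a.1, a.2) in f0_ok.
have [sok /allP mok /allP cok] := st_ok.
set C' := conf (target_setting st f0).
pose P c := exists2 f, f \in C' & c \in f.2.
have qP : sentence_ok (sch st) P q.
  case: qok => h1 h2 h3; split=> // c /h3 [f fC cf]; exists (copy_fact true f) => //.
  by rewrite mem_cat map_f.
(* The left-hand query mentions the values of [f0]; they are present in the second copy, which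
   contains [f0] from the start. *)
have fP c : c \in f0.2 -> P c.
  by move=> cf; exists (copy_fact false f0) => //; rewrite mem_cat map_f ?orbT // mem_head.
have q2 := sentence_ok_copy true qP.
split; last exact/query_okE.
- split; first exact: schema_ok_copies.
  + apply/allP => m; rewrite mem_cat => /orP[] /mapP [m' /mok /andP[h1 h2] ->];
      by rewrite /method_ok /mrel /= mem_rels_copies h1 doms_copies size_map.
  + apply/allP => f; rewrite mem_cat => /orP[] /mapP [f' f'C ->]; rewrite fact_ok_copy.
      exact: cok.
    by move: f'C; rewrite inE => /orP[/eqP ->|/cok].
- apply/query_okE/sentence_ok_or; first exact: sentence_ok_atom_with.
  apply: sentence_ok_and; first exact: sentence_ok_copy.
  exact: sentence_ok_unlocked.
Qed.

(** * Correctness of the reduction *)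

Lemma mem_copy_facts b f s1 s0 :
  (copy_fact b f \in map (copy_fact true) s1 ++ map (copy_fact false) s0) =
  (f \in if b then s1 else s0).
Proof.
have inj c : injective (copy_fact c) by move=> [r k] [r' k'] [-> ->].
have no c c' s : c != c' -> (copy_fact c f \in map (copy_fact c') s) = false.
  by move=> cc; apply/mapP => -[g _ [e]]; rewrite e eqxx in cc.
by rewrite mem_cat; case: b; rewrite (mem_map (inj _)) no ?orbF.
Qed.

Lemma reduction_correct x : valid (p := ltr_problem) x ->
  yes (p := ltr_problem) x <-> ~ yes (p := containment_problem) (reduction x).
Proof.
move=> vx; have := valid_reduction vx; move: vx.
case: x => -[st a] q [st_ok ab wfa qok] [st2_ok ql qr].
have f0_ok := access_fact_ok st_ok ab wfa.
rewrite [yes _]/= (long_term_relevantP q st_ok ab wfa).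
set f0 := (mrel a.1, a.2) in f0_ok ql *.
rewrite [yes _]/= -/f0.
set st2 := target_setting st f0 in st2_ok ql qr *.
have iC2 := conf_instance st2_ok; have iC := conf_instance st_ok.
have [fq [G tq] cq] := qok.
have [flq _ _] := ql; have [frq _ _] := qr.
have memc b f : part b (conf_set st2) f <-> f \in (if b then conf st else f0 :: conf st).
  by rewrite -mem_copy_facts.
have part1 : part true (conf_set st2) = conf_set st.
  by apply/seteqP; split=> f /(memc true).
have part0 : part false (conf_set st2) = conf_set st `|` [set f0].
  apply/seteqP; split=> f.
    by move/(memc false); rewrite inE => /orP[/eqP|]; [right|left].
  by case=> [fC|->]; apply/(memc false); rewrite inE ?eqxx // fC orbT.
have right_sat D v : sat D v (copy_query true q) <-> sat (part true D) v q.
  exact: sat_copy_query (tq).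
have left_sat D v : sat D v (copy_query false q) <-> sat (part false D) v q.
  exact: sat_copy_query (tq).
split.
  case=> D [rD nD hD] cont; have iD := reach_instance iC rD; have CD := reach_sub rD.
  (* When [f0] alone makes the query true, the second copy stays in its initial configuration. *)
  have [E rE hE] : exists2 E, reach (sch st) (acs st) (conf_set st `|` [set f0]) E &
      holds (D `|` [set f0]) q \/ unlocks st f0 D /\ holds E q.
    case: hD => [hD|[[b [h1 h2]] [E rE hE]]].
      by exists (conf_set st `|` [set f0]); [apply: reach_refl | left].
    by exists E => //; right; split=> //; apply: unlocks_of_access h1 h2.
  have sub1 : conf_set st `<=` part true (conf_set st2) by rewrite part1.
  (* The first copy is driven to [D], then the second one to [E]. *)
  have [F1 [rF1 F1t F1f]] := lift_reach (b := true) rD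
    (reach_refl (two_copies (sch st)) (two_method_copies (acs st)) (conf_set st2)) sub1.
  have sub0 : conf_set st `|` [set f0] `<=` part false F1 by rewrite F1f part0.
  have [F [rF Ff Ft]] := lift_reach (b := false) rE rF1 sub0.
  have {}Ft : part true F = D by rewrite Ft F1t part1; apply: setUidr.
  have {}Ff : part false F = E.
    by rewrite Ff F1f part0; apply/setUidr/(reach_sub rE).
  have nF v : ~ sat F v (copy_query true q).
    by move=> /right_sat; rewrite Ft => /(sat_closed fq).
  apply: (nF id); apply: cont => [|v]; first by exact: (proj2 (reachableE _ _ iC2) rF).
  case: hE => [hE|[un hE]].
    by left; apply/(sat_atom_with F v f0_ok tq); rewrite Ft.
  right; split; first by apply/left_sat; rewrite Ff.
  by apply/(sat_unlocked _ st_ok _ (nF v)); rewrite Ft.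
move=> ncont.
have [F [rF hl nr]] : exists F, [/\ reachable (sch st2) (acs st2) (conf_set st2) F,
    holds F (target_left st f0 q) & ~ holds F (copy_query true q)].
  apply: contrapT => no; apply: ncont => F rF hl; apply: contrapT => nr.
  by apply: no; exists F.
have {}rF : reach (two_copies (sch st)) (two_method_copies (acs st)) (conf_set st2) F.
  exact: (proj1 (reachableE _ _ iC2) rF).
have rt := part_reach true rF; have rf := part_reach false rF.
rewrite part1 in rt; rewrite part0 in rf.
have it := reach_instance iC rt.
have nD : ~ holds (part true F) q by move=> h; apply: nr => v; apply/right_sat.
have nF : ~ sat F id (copy_query true q).
  by move=> /right_sat /(sat_closed fq).
case: (hl id) => [/(sat_atom_with _ _ f0_ok tq) /(sat_closed fq) h|[/left_sat /(sat_closed fq) h]].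
  by exists (part true F); split=> //; left.
move=> /(sat_unlocked _ st_ok it nF) un.
(* [D] is a renaming of the first part of [F]. The second part is kept as it is, since the condition
   on [E] does not involve [D]. *)
have [D [rD nD' acc]] := access_of_unlocks st_ok f0_ok fq cq rt nD un.
by exists D; split=> //; right; split=> //; exists (part false F).
Qed.

Theorem proposition3p4 :
  polytime_many_one_reducible ltr_problem (complement containment_problem).
Proof.
exists reduction; first exact: polytime_of_pt pt_reduction.
by move=> x vx; split; [apply: valid_reduction | apply: reduction_correct].
Qed.
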